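(* Let $\mathbb F$ be a non-archimedean local field of characteristic $0$, $W$ an $\mathbb F$-vector space of dimension $n+1\ge 2$, and $W=V\oplus U$ with $\dim V=n$. Suppose that every distribution on $GL(W)$ which is invariant under the adjoint (conjugation) action of $GL(V)$ is invariant by transposition. Then for every irreducible admissible representation $\pi$ of $GL(W)$ and every irreducible admissible representation $\rho$ of $GL(V)$, $$\dim\bigl(\mathrm{Hom}_{GL(V)}(\pi_{|GL(V)},\rho)\bigr)\le 1 .$$
   Context: $GL(V)$ is embedded in $GL(W)$ as the subgroup preserving $V$ and acting trivially on $U$. For a totally disconnected, locally compact Hausdorff space $X$ countable at infinity, $\mathcal S(X)$ is the space of locally constant compactly supported functions $X\to\mathbb C$ and distributions are linear forms on $\mathcal S(X)$; $T$ is invariant under a homeomorphism $\phi$ if $\langle T,f\circ\phi\rangle=\langle T,f\rangle$ for all $f$. Choosing a basis of $V$ and a non-zero vector in $U$ identifies $GL(W)$ with $GL(n+1,\mathbb F)$ and $GL(V)$ with $GL(n,\mathbb F)$; transposition is $g\mapsto{}^tg$ in this identification, and its action on $GL(V)$-invariant distributions does not depend on the choices. *)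

(* Defs.v *)
From HB Require Import structures.
From mathcomp Require Import all_boot all_order all_algebra.
From mathcomp Require Import all_classical all_reals all_analysis.
From mathcomp Require Import complex.

Set Implicit Arguments.
Unset Strict Implicit.
Unset Printing Implicit Defensive.

Import Order.TTheory GRing.Theory Num.Theory.

Local Open Scope classical_set_scope.
Local Open Scope ring_scope.

(* Fields carrying a topology; the compatibility of the two structures is part
   of [nonarchimedean_local_field], since the topology is required there to be
   the one defined by an absolute value. *)
#[short(type="preTopologicalFieldType")]
HB.structure Definition PreTopologicalField :=
  {F of Topological F & GRing.Field F}.

Record nonarchimedean_abs (R : realType) (F : fieldType) (nu : F -> R) : Prop :=
  NonarchimedeanAbs {
    nonarch_abs_ge0 : forall x, 0 <= nu x;
    nonarch_abs_eq0 : forall x, nu x = 0 <-> x = 0;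
    nonarch_absM : forall x y, nu (x * y) = nu x * nu y;
    nonarch_absD : forall x y, nu (x + y) <= Num.max (nu x) (nu y);
    nonarch_abs_nontrivial : exists2 x, x != 0 & nu x != 1
  }.

Definition nonarchimedean_local_field (R : realType)
    (F : preTopologicalFieldType) : Prop :=
  locally_compact [set: F] /\
  exists2 nu : F -> R, nonarchimedean_abs nu &
    forall x : F, nbhs x =
      filter_from [set e : R | 0 < e] (fun e => [set y | nu (y - x) < e]).

(* Dimension at most [d]; meaningful only when [S] is a linear subspace. *)
Definition dim_le (K : fieldType) (E : lmodType K) (S : set E) (d : nat) : Prop :=
  exists2 b : 'I_d -> E, (forall i, S (b i)) &
    forall v, S v -> exists c : 'I_d -> K, v = \sum_i c i *: b i.

Definition finite_dim (K : fieldType) (E : lmodType K) (S : set E) : Prop :=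
  exists d, dim_le S d.

(* Groups carrying a topology; no definition below uses the continuity of the
   group operations, so it is not bundled. *)
#[short(type="preTopologicalGroupType")]
HB.structure Definition PreTopologicalGroup :=
  {G of Topological G & Group G}.

Section Distributions.
Variables (R : realType) (X : topologicalType).

Definition locally_constant (f : X -> R[i]) : Prop :=
  forall x, \forall y \near x, f y = f x.

Definition compact_support (f : X -> R[i]) : Prop :=
  compact (closure [set x | f x != 0]).

Definition schwartz_pred : {pred X -> R[i]} :=
  fun f => `[< locally_constant f /\ compact_support f >].

Lemma schwartz_submod_closed : submod_closed schwartz_pred.
Proof.
split=> [|a f g /asboolP[lf cf] /asboolP[lg cg]]; apply/asboolP.
  split=> [x|]; first by apply: nearW.
  rewrite /compact_support (_ : [set x | _] = set0) ?closure0; first exact: compact0.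
  by apply/seteqP; split=> x //=; rewrite /= eqxx.
split=> [x|].
  have lfx := lf x; have lgx := lg x; near=> y.
  have -> : (a *: f + g) y = a * f y + g y by [].
  have -> : (a *: f + g) x = a * f x + g x by [].
  have -> : f y = f x by near: y.
  by have -> : g y = g x by near: y.
rewrite /compact_support.
apply: (subclosed_compact _ (compactU cf cg)); first exact: closed_closure.
rewrite -closureU; apply: closureS => x /= nz.
have [fx0|] := eqVneq (f x) 0; last by left.
right; apply: contraNneq nz => gx0.
by rewrite [_ x](_ : _ = a * f x + g x) // fx0 gx0 mulr0 addr0.
Unshelve. all: by end_near.
Qed.

HB.instance Definition _ :=
  GRing.isSubmodClosed.Build R[i] (X -> R[i]) schwartz_pred
    schwartz_submod_closed.

Record schwartz : predArgType := Schwartz {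
  schwartz_fun :> X -> R[i];
  _ : schwartz_fun \in schwartz_pred
}.

HB.instance Definition _ := [isSub of schwartz for schwartz_fun].
HB.instance Definition _ := [Choice of schwartz by <:].
HB.instance Definition _ := [SubChoice_isSubZmodule of schwartz by <:].
HB.instance Definition _ := [SubZmodule_isSubLmodule of schwartz by <:].

Definition distrib : Type := {scalar schwartz}.

(* <T, f o phi> = <T, f>, where [h] is the element f o phi of S(X). *)
Definition distr_invariant (T : distrib) (phi : X -> X) : Prop :=
  forall f h : schwartz, (h : X -> R[i]) = f \o phi -> T h = T f.

End Distributions.

Section Representations.
Variable R : realType.

Record representation (G : groupType) (E : lmodType R[i]) := Representation {
  rep_fun :> G -> {linear E -> E};
  rep1 : forall v, rep_fun 1%g v = v;
  repM : forall g h v, rep_fun (g * h)%g v = rep_fun g (rep_fun h v)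
}.

Definition rep_irreducible (G : groupType) (E : lmodType R[i])
    (pi : representation G E) : Prop :=
  (exists v : E, v != 0) /\
  forall S : {pred E}, submod_closed S ->
    (forall g v, v \in S -> pi g v \in S) ->
    S =i pred1 0 \/ S =i predT.

Definition rep_smooth (G : preTopologicalGroupType) (E : lmodType R[i])
    (pi : representation G E) : Prop :=
  forall v : E, open [set g | pi g v = v].

Definition compact_open_subgroup (G : preTopologicalGroupType) (K : set G) :
    Prop :=
  [/\ compact K, open K, K 1%g,
      forall g h, K g -> K h -> K (g * h)%g & forall g, K g -> K g^-1%g].

Definition rep_admissible (G : preTopologicalGroupType) (E : lmodType R[i])
    (pi : representation G E) : Prop :=
  rep_smooth pi /\
  forall K : set G, compact_open_subgroup K ->
    finite_dim [set v | forall g, K g -> pi g v = v].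

Section Restriction.
Variables (H G : groupType) (f : UMagmaMorphism.type H G).
Variables (E : lmodType R[i]) (pi : representation G E).

Fact rep_restrict1 v : pi (f 1%g) v = v.
Proof. by rewrite gmulf1 rep1. Qed.

Fact rep_restrictM g h v : pi (f (g * h)%g) v = pi (f g) (pi (f h) v).
Proof. by rewrite gmulfM repM. Qed.

Definition rep_restrict : representation H E :=
  @Representation H E (fun h => pi (f h)) rep_restrict1 rep_restrictM.

End Restriction.

(* The space Hom_G(pi, rho), inside the vector space of all maps E -> E'. *)
Definition rep_Hom (G : groupType) (E E' : lmodType R[i])
    (pi : representation G E) (rho : representation G E') : set (E -> E') :=
  [set A | linear A /\ forall g v, A (pi g v) = rho g (A v)].

End Representations.

Section GeneralLinearGroup.
Variables (F : fieldType) (E : vectType F).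

Record GL : predArgType := MkGL {
  GLlfun :> 'End(E);
  _ : lker GLlfun == 0%VS
}.

HB.instance Definition _ := [isSub of GL for GLlfun].
HB.instance Definition _ := [Choice of GL by <:].

Lemma GL_lker0 (g : GL) : lker g == 0%VS.
Proof. exact: valP g. Qed.

Fact GL_one_subproof : lker (\1%VF : 'End(E)) == 0%VS.
Proof. by apply/lker0P => u v; rewrite !lfunE. Qed.

Fact GL_mul_subproof (g h : GL) : lker (g \o h)%VF == 0%VS.
Proof.
apply/lker0P => u v; rewrite !comp_lfunE.
by move=> /(lker0P (GL_lker0 g)) /(lker0P (GL_lker0 h)).
Qed.

Fact GL_inv_subproof (g : GL) : lker (g^-1)%VF == 0%VS.
Proof. by apply/lker0P; apply: can_inj (lker0_lfunVK (GL_lker0 g)). Qed.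

Definition GL_one : GL := MkGL GL_one_subproof.
Definition GL_mul (g h : GL) : GL := MkGL (GL_mul_subproof g h).
Definition GL_inv (g : GL) : GL := MkGL (GL_inv_subproof g).

Fact GL_mulA : associative GL_mul.
Proof. by move=> f g h; apply: val_inj; apply: comp_lfunA. Qed.
Fact GL_mul1 : left_id GL_one GL_mul.
Proof. by move=> f; apply: val_inj; apply: comp_lfun1l. Qed.
Fact GL_mulr1 : right_id GL_one GL_mul.
Proof. by move=> f; apply: val_inj; apply: comp_lfun1r. Qed.
Fact GL_mulV : left_inverse GL_one GL_inv GL_mul.
Proof. by move=> f; apply: val_inj; apply: lker0_compVf (GL_lker0 f). Qed.
Fact GL_mulrV : right_inverse GL_one GL_inv GL_mul.
Proof. by move=> f; apply: val_inj; apply: lker0_compfV (GL_lker0 f). Qed.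

HB.instance Definition _ :=
  isGroup.Build GL GL_mulA GL_mul1 GL_mulr1 GL_mulV GL_mulrV.

Lemma GL_oneE : GLlfun 1%g = \1%VF. Proof. by []. Qed.
Lemma GL_mulE (g h : GL) : GLlfun (g * h)%g = (g \o h)%VF. Proof. by []. Qed.
Lemma GL_invE (g : GL) : GLlfun g^-1%g = (g^-1)%VF. Proof. by []. Qed.

(* Transposition in the coordinates of a basis [e]. [passmx.mxof] lets matrices
   act on row vectors; transposition is the same for either convention. *)
Section Transposition.
Variables (e : (\dim {:E}).-tuple E) (eP : basis_of {:E} e).

Definition tr_lfun (g : 'End(E)) : 'End(E) :=
  passmx.hommx e e (passmx.mxof e e g)^T.

Fact GL_tr_subproof (g : GL) : lker (tr_lfun g) == 0%VS.
Proof.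
have E1 : (tr_lfun (g^-1)%VF \o tr_lfun g)%VF = \1%VF.
  rewrite /tr_lfun -passmx.hommx_mul // -trmx_mul -passmx.mxof_comp //.
  rewrite lker0_compfV ?GL_lker0 // passmx.mxof1 ?(basis_free eP) //.
  by rewrite trmx1 -(passmx.mxof1 (basis_free eP)) passmx.mxofK.
apply/lker0P => u v /(congr1 (tr_lfun (g^-1)%VF)).
by rewrite -!comp_lfunE E1 !id_lfunE.
Qed.

Definition GL_tr (g : GL) : GL := MkGL (GL_tr_subproof g).

Lemma mxof_GL_tr (g : GL) :
  passmx.mxof e e (GL_tr g) = (passmx.mxof e e g)^T.
Proof. exact: passmx.hommxK. Qed.

End Transposition.

End GeneralLinearGroup.

(* The topology of GL(E) is that of invertible matrices, as a subspace of all
   matrices; it does not depend on the basis, here [vbasis]. *)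
Definition GL_mx (F : preTopologicalFieldType) (E : vectType F) (g : GL E) :
    'M[F]_(\dim {:E}) :=
  passmx.mxof (vbasis {:E}) (vbasis {:E}) g.

HB.instance Definition _ (F : preTopologicalFieldType) (E : vectType F) :=
  Topological.copy (GL E) (initial_topology (@GL_mx F E)).

Section Embedding.
Variables (F : fieldType) (W : vectType F) (V U : {vspace W}).

Definition direct_sum_decomposition : bool :=
  (V + U == fullv)%VS && (V :&: U == 0)%VS.

Hypothesis VU : direct_sum_decomposition.

(* g (+) id_U on W = V (+) U. *)
Definition lfun_extend (g : 'End(subvs_of V)) : 'End(W) :=
  (linfun vsval \o g \o linfun (vsproj V) \o daddv_pi V U + daddv_pi U V)%VF.

Let capVU : (V :&: U = 0)%VS. Proof. by case/andP: VU => _ /eqP. Qed.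
Let capUV : (U :&: V = 0)%VS. Proof. by rewrite capvC. Qed.

Let daddv_pi0 (A B : {vspace W}) w :
  (A :&: B = 0)%VS -> w \in B -> daddv_pi A B w = 0.
Proof.
move=> cAB wB; have cBA : (B :&: A = 0)%VS by rewrite capvC.
have := daddv_pi_add cAB (subvP (addvSr A B) _ wB).
by rewrite (daddv_pi_id cBA wB) => /(canRL (addrK _)); rewrite subrr.
Qed.

Lemma lfun_extend_V g (v : subvs_of V) : lfun_extend g (vsval v) = vsval (g v).
Proof.
rewrite add_lfunE !comp_lfunE !lfunE /= daddv_pi_id ?subvsP // vsvalK.
by rewrite daddv_pi0 ?subvsP // addr0.
Qed.

Lemma lfun_extend_U g u : u \in U -> lfun_extend g u = u.
Proof.
move=> uU; rewrite add_lfunE !comp_lfunE daddv_pi0 // !linear0 add0r.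
exact: daddv_pi_id.
Qed.

Let decomp w : exists v : subvs_of V, exists2 u, u \in U & w = vsval v + u.
Proof.
have /memv_addP[v vV [u uU ->]] : w \in (V + U)%VS.
  by case/andP: VU => /eqP -> _; apply: memvf.
by exists (vsproj V v), u => //; rewrite vsprojK.
Qed.

Lemma lfun_extend1 : lfun_extend \1%VF = \1%VF.
Proof.
apply/lfunP => w; have [v [u uU ->]] := decomp w.
by rewrite linearD /= lfun_extend_V lfun_extend_U // !id_lfunE.
Qed.

Lemma lfun_extendM g h :
  lfun_extend (g \o h)%VF = (lfun_extend g \o lfun_extend h)%VF.
Proof.
apply/lfunP => w; have [v [u uU ->]] := decomp w.
rewrite comp_lfunE !linearD /= !lfun_extend_V !lfun_extend_U //.
by rewrite comp_lfunE.
Qed.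

Fact GL_embed_subproof (g : GL (subvs_of V)) : lker (lfun_extend g) == 0%VS.
Proof.
apply/lker0P => u v /(congr1 (lfun_extend (g^-1)%VF)).
rewrite -!comp_lfunE -lfun_extendM lker0_compVf ?GL_lker0 //.
by rewrite lfun_extend1 !id_lfunE.
Qed.

(* GL(V) as the subgroup of GL(W) preserving V and acting trivially on U. *)
Definition GL_embed (g : GL (subvs_of V)) : GL W := MkGL (GL_embed_subproof g).

Fact GL_embed_monoid_morphism : monoid.monoid_morphism GL_embed.
Proof.
split=> [|g h]; apply: val_inj; first exact: lfun_extend1.
exact: lfun_extendM.
Qed.

HB.instance Definition _ :=
  isUMagmaMorphism.Build _ _ GL_embed GL_embed_monoid_morphism.

Definition adapted_basis (e : seq W) : Prop :=
  exists b u, [/\ e = rcons b u, basis_of V b, u \in U & u != 0].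

End Embedding.

(* Main.v *)
From HB Require Import structures.
Require Import Defs.
From mathcomp Require Import all_boot all_order all_algebra.
From mathcomp Require Import all_classical all_reals all_analysis.
From mathcomp Require Import complex spectral.

(* Gelfand-Kazhdan method. Write t for transposition, on GL(W) and on GL(V).
   A distribution on GL(W) invariant under conjugation by GL(V) is t-invariant;
   this applies to the character of pi, and also to the character of rho pushed
   forward to GL(W). It follows that pi and rho carry non-degenerate bilinear
   forms, symmetric or antisymmetric, with b(pi(g) x, y) = b(x, pi(t g) y).

   The operators pi(f) then lie in E (x) E. For A, B in Hom(pi, rho) the linear
   form sending v (x) w to b_rho(A v, B w), composed with f |-> pi(f), is a
   distribution invariant under GL(V). Since t exchanges the two factors of
   E (x) E up to a sign eps, b_rho(A v, B w) = eps b_rho(A w, B v) for all v, w.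
   Hence A v = 0 forces B v = 0, and B is a multiple of A by Schur's lemma.

   Integration over GL(W) is finite summation over the cosets of principal
   congruence subgroups. It is right invariant because the modulus D satisfies
   D(t g) = D(g)^-1 and GL is generated by symmetric matrices and unipotents. *)

Set Implicit Arguments.
Unset Strict Implicit.
Unset Printing Implicit Defensive.

Import Order.TTheory GRing.Theory Num.Theory.

Local Open Scope classical_set_scope.
Local Open Scope ring_scope.

(** * Linear algebra and irreducible representations *)

(** The spaces may be infinite-dimensional, so traces and tensors are built by hand: an operator of
    finite rank is carried by a list of pairs, and what a bilinear map yields on the list depends on
    the operator alone. The invariant form stands in for an identification of pi with its twisted
    contragredient. It exists because the kernel of f |-> pi(f) is stable under f |-> f o t: if
    pi(f) = 0, t-invariance of the character gives tr(pi(y) pi(f o t)) = 0 for all y, and by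
    Jacobson density this trace pairing separates operators of finite rank. So pi(f) determines pi(f
    o t), and a rank one pi(f) turns this correspondence into a form. A priori pi(f) lies in E (x)
    E^*, with the full dual. It lies in E (x) E because it has an adjoint, pi(f o t); only there
    does exchanging the two factors make sense. The hypothesis concerns GL(W) alone. It reaches the
    character of rho because every test function on GL(V) is the restriction of one on GL(W).
    Characteristic 0 enters through 2 != 0, which makes a unipotent conjugate to its square. *)

Section LinearMaps.
Variables (K : fieldType) (E Z : lmodType K) (f : E -> Z).
Hypothesis lf : linear f.

Lemma linear_fun0 : f 0 = 0.
Proof. by have := lf (-1) 0 0; rewrite !scaleN1r !addNr. Qed.

Lemma linear_funD u v : f (u + v) = f u + f v.
Proof. by have := lf 1 u v; rewrite !scale1r. Qed.

Lemma linear_funZ c u : f (c *: u) = c *: f u.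
Proof. by have := lf c u 0; rewrite linear_fun0 !addr0. Qed.

Lemma linear_funB u v : f (u - v) = f u - f v.
Proof. by rewrite -!scaleN1r linear_funD linear_funZ. Qed.

Lemma linear_fun_sum (I : Type) (r : seq I) (P : pred I) (F : I -> E) :
  f (\sum_(i <- r | P i) F i) = \sum_(i <- r | P i) f (F i).
Proof. by apply: (big_morph f linear_funD linear_fun0). Qed.

Lemma linear_fun_sumZ (I : Type) (r : seq I) (c : I -> K) (F : I -> E) :
  f (\sum_(i <- r) c i *: F i) = \sum_(i <- r) c i *: f (F i).
Proof. by rewrite linear_fun_sum; apply: eq_bigr => i _; rewrite linear_funZ. Qed.

End LinearMaps.

Section LinearSpan.
Variables (K : fieldType) (E : lmodType K).

(** Coefficients are peeled off one at a time, to match the inductions of [tensor_absorb] and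
    [density]. *)
Fixpoint spanned (s : seq E) (v : E) : Prop :=
  if s is u :: s' then exists c, spanned s' (v - c *: u) else v = 0.

Lemma spannedZ s a v : spanned s v -> spanned s (a *: v).
Proof.
elim: s v => /= [v ->|w s IHs v [c sc]]; first by rewrite scaler0.
by exists (a * c); rewrite -scalerA -scalerBr; apply: IHs.
Qed.

Record bilin (M Z : lmodType K) (phi : E -> M -> Z) : Prop := Bilin {
  bilinl : forall m, linear (phi ^~ m);
  bilinr : forall v, linear (phi v)
}.

(* A tensor sum_i v_i (x) m_i is represented by the list of the (v_i, m_i);
   equality of tensors is equality of the values of all bilinear maps. *)
Lemma tensor_absorb (M : lmodType K) (l : seq (E * M)) (v : E) (m : M) :
  spanned (unzip1 l) v ->
  exists l', size l' = size l /\
    forall (Z : lmodType K) (phi : E -> M -> Z), bilin phi ->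
      \sum_(p <- (v, m) :: l) phi p.1 p.2 = \sum_(p <- l') phi p.1 p.2.
Proof.
elim: l v m => [v m /= ->|[u n] l IHl v m /= [c /IHl-/(_ m) [l' [sl' El']]]].
  exists [::]; split=> // Z phi [bl _].
  by rewrite big_cons big_nil /= (linear_fun0 (bl m)) addr0.
(* v (x) m + u (x) n = (v - c u) (x) m + u (x) (n + c m), and the first term on the right is
   absorbed by induction. *)
exists ((u, n + c *: m) :: l'); split=> [|Z phi bphi]; first by rewrite /= sl'.
have [bl br] := bphi.
rewrite [RHS]big_cons -El' // !big_cons /= (linear_funD (br u)).
rewrite (linear_funZ (br u)) (linear_funB (bl m)) (linear_funZ (bl m)).
set A := phi v m; set C := c *: phi u m.
by rewrite -addrA [C + _]addrA [C + _]addrC subrK addrCA.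
Qed.

(** A spanning family of least size is free: a relation with a nonzero coefficient at [i] would let
    [b i] be dropped. *)
Lemma finite_dim_basis (S : set E) : finite_dim S ->
  exists d (b : 'I_d -> E), [/\ forall i, S (b i),
    forall v, S v -> exists c : 'I_d -> K, v = \sum_i c i *: b i &
    forall c : 'I_d -> K, \sum_i c i *: b i = 0 -> forall i, c i = 0].
Proof.
move=> fS; have exd : exists d, `[< dim_le S d >].
  by case: fS => d Sd; exists d; apply/asboolP.
case: (ex_minnP exd) => d /asboolP[b Sb gen] dmin; exists d, b; split=> // c c0.
move=> i; apply: contrapT => /eqP ci.
case: d => [|d] in b Sb gen dmin c c0 i ci *; first by case: i ci.
suff /asboolP/dmin : dim_le S d by rewrite ltnn.
exists (fun j => b (lift i j)) => // v /gen[x ->].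
exists (fun j => x (lift i j) - x i / c i * c (lift i j)).
move/eqP: c0; rewrite (bigD1_ord i) //= addrC addr_eq0 => /eqP c0.
rewrite (bigD1_ord i) //=.
have -> : x i *: b i = - (x i / c i) *: \sum_j c (lift i j) *: b (lift i j).
  by rewrite c0 scaleNr scalerN opprK scalerA divfK.
rewrite scaler_sumr -big_split /=; apply: eq_bigr => j _.
by rewrite scalerA -scalerDl mulNr addrC.
Qed.

End LinearSpan.

Lemma eigenvector (K : numClosedFieldType) (E : lmodType K) (S : set E) (T : E -> E) :
  finite_dim S -> linear T -> (forall v, S v -> S (T v)) ->
  (exists2 v, S v & v != 0) -> exists2 v, v != 0 & exists c, T v = c *: v.
Proof.
move=> /finite_dim_basis[d [b [Sb gen fr]]] lT ST [v Sv v0].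
have d_gt0 : (0 < d)%N.
  rewrite lt0n; apply: contra_neq v0 => d0; have [c ->] := gen _ Sv.
  by apply: big1 => i _; have := leq_ltn_trans (leq0n i) (ltn_ord i); rewrite [X in (_ < X)%N]d0.
have /choice[M TM] : forall j, exists c : 'I_d -> K, T (b j) = \sum_i c i *: b i.
  by move=> j; apply: gen; apply: ST.
(* Row [j] holds the coordinates of [T (b j)], so a row eigenvector is the coordinate vector of an
   eigenvector of [T]. *)
have [a /eigenvalueP[x xM x0]] := eigenvalue_closed (\matrix_(j, i) M j i) d_gt0.
exists (\sum_j x ord0 j *: b j).
  apply: contra_neq x0 => /fr x0; apply/rowP => j; rewrite mxE; exact: x0.
exists a; rewrite linear_fun_sumZ // scaler_sumr.
under eq_bigr do rewrite TM scaler_sumr.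
rewrite exchange_big /=; apply: eq_bigr => i _.
under eq_bigr do rewrite scalerA.
rewrite -scaler_suml scalerA; congr (_ *: _).
move/rowP/(_ i): xM; rewrite !mxE => <-.
by apply: eq_bigr => j _; rewrite mxE.
Qed.

Section Dual.
Variables (K : fieldType) (E : lmodType K).

(** The full algebraic dual: the coordinates of a finite-rank operator are arbitrary linear
    forms. *)
Definition dual_pred : {pred E -> K^o} := fun f => `[< linear f >].

Lemma dual_submod_closed : submod_closed dual_pred.
Proof.
split=> [|a f g /asboolP lf /asboolP lg]; apply/asboolP => c u v.
  by rewrite /= scaler0 addr0.
have E1 w : (a *: f + g) w = a *: f w + g w by [].
by rewrite !E1 lf lg !scalerDr !scalerA [c * a]mulrC addrACA.
Qed.

HB.instance Definition _ :=
  GRing.isSubmodClosed.Build K (E -> K^o) dual_pred dual_submod_closed.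

Record dual : predArgType := Dual {
  dual_fun :> E -> K^o;
  _ : dual_fun \in dual_pred
}.

HB.instance Definition _ := [isSub of dual for dual_fun].
HB.instance Definition _ := [Choice of dual by <:].
HB.instance Definition _ := [SubChoice_isSubZmodule of dual by <:].
HB.instance Definition _ := [SubZmodule_isSubLmodule of dual by <:].

Lemma dual_linear (f : dual) : linear f.
Proof. by case: f => f /= /asboolP. Qed.

Definition mkdual (f : E -> K^o) (lf : linear f) : dual := Dual (asboolT lf).

Definition dual_ev (m : dual) (x : E) : K^o := m x.

Lemma dual_ev_bilin : bilin dual_ev.
Proof. by split=> [x a m n|m]; last exact: dual_linear. Qed.

End Dual.

(** * Finite-rank operators as tensors *)

Section Tensors.
Variables (K : fieldType) (E M : lmodType K) (ev : M -> E -> K^o).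
Hypothesis evb : bilin ev.

(* X is the image of the tensor l under E (x) M -> End(E). *)
Definition decomp (X : E -> E) (l : seq (E * M)) : Prop :=
  forall x, X x = \sum_(p <- l) ev p.2 x *: p.1.

(** Evaluation at [x] of E (x) M -> End(E); through it [tensor_absorb] preserves [decomp]. *)
Lemma bilin_ev_op x : bilin (fun (v : E) (m : M) => ev m x *: v : E).
Proof.
split=> [m|v] a u w; first by rewrite scalerDr !scalerA mulrC.
by rewrite (bilinl evb) scalerDl scalerA.
Qed.

Hypothesis ev_inj : forall m, (forall x, ev m x = 0) -> m = 0.

(** Injectivity of E (x) M -> End(E). A leading vector in the span of the others is absorbed, which
    shortens the list; otherwise its coefficient [ev m x] must vanish for every x, so [m] = 0. *)
Lemma decomp_eq0 (Z : lmodType K) (phi : E -> M -> Z) l : bilin phi ->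
  decomp (fun=> 0) l -> \sum_(p <- l) phi p.1 p.2 = 0.
Proof.
move=> bphi.
have [n] := ubnP (size l); elim: n l => // n IHn [|[v m] l] /=; first by rewrite big_nil.
rewrite ltnS => szl Hl.
have [sv|nsv] := pselect (spanned (unzip1 l) v).
  have [l' [szl' El']] := tensor_absorb m sv.
  rewrite El' //; apply: IHn; first by rewrite szl'.
  by move=> x; rewrite -(El' _ _ (bilin_ev_op x)) -Hl.
have ev0 x : ev m x = 0.
  apply: contrapT => /eqP m0; apply: nsv.
  have /eqP := Hl x; rewrite big_cons /= eq_sym addr_eq0 => /eqP E1.
  suff : spanned (unzip1 l) (\sum_(p <- l) ev p.2 x *: p.1).
    move=> /(spannedZ (- (ev m x)^-1)).
    by rewrite -[\sum_(p <- l) _]opprK -E1 scalerN scaleNr opprK scalerA mulVf ?scale1r.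
  elim: (l) => [|[u k] l' IH]; first by rewrite big_nil.
  by rewrite big_cons /=; exists (ev k x); rewrite addrAC subrr add0r.
have m0 : m = 0 by apply: ev_inj.
rewrite big_cons /= m0 (linear_fun0 (bilinr bphi v)) add0r; apply: IHn => // x.
by have := Hl x; rewrite big_cons /= ev0 scale0r add0r.
Qed.

Lemma decomp_inj (phi : E -> M -> K^o) X l l' : bilin phi ->
  decomp X l -> decomp X l' ->
  \sum_(p <- l) phi p.1 p.2 = \sum_(p <- l') phi p.1 p.2.
Proof.
move=> bphi Xl Xl'; apply/eqP; rewrite -subr_eq0; apply/eqP.
have D0 : decomp (fun=> 0) (l ++ [seq (- p.1, p.2) | p <- l']).
  move=> x; rewrite big_cat big_map /= -Xl.
  under eq_bigr do rewrite scalerN.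
  by rewrite sumrN -Xl' subrr.
rewrite -[RHS](decomp_eq0 bphi D0) big_cat big_map /= -sumrN.
congr (_ + _); apply: eq_bigr => p _.
by rewrite -[- p.1]scaleN1r (linear_funZ (bilinl bphi _)) scaleN1r.
Qed.

(** The trace, when [phi] is the evaluation pairing. Any decomposition may be picked, by
    [decomp_inj]; an operator without one gets 0. *)
Definition tensor_form (phi : E -> M -> K^o) (X : E -> E) : K^o :=
  xget 0 [set c | exists2 l, decomp X l & c = \sum_(p <- l) phi p.1 p.2].

Lemma tensor_formE phi X l : bilin phi -> decomp X l ->
  tensor_form phi X = \sum_(p <- l) phi p.1 p.2.
Proof.
move=> bphi Xl; rewrite /tensor_form; case: xgetP => [c -> /= [l' Xl' ->]|].
  exact: decomp_inj Xl' Xl.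
by move/(_ (\sum_(p <- l) phi p.1 p.2)); case; exists l.
Qed.

Lemma decompD X Y l l' : decomp X l -> decomp Y l' ->
  decomp (fun x => X x + Y x) (l ++ l').
Proof. by move=> Xl Yl' x; rewrite big_cat /= -Xl -Yl'. Qed.

Lemma decomp_comp X l (L : E -> E) : linear L -> decomp X l ->
  decomp (L \o X) [seq (L p.1, p.2) | p <- l].
Proof. by move=> lL Xl x; rewrite /= Xl linear_fun_sumZ // big_map. Qed.

Lemma decompZ X l c : decomp X l ->
  decomp (fun x => c *: X x) [seq (c *: p.1, p.2) | p <- l].
Proof.
move=> Xl; apply: (@decomp_comp X l (fun v => c *: v)) => // a u v.
by rewrite scalerDr !scalerA mulrC.
Qed.

Lemma tensor_form_comb phi a X Y Z l l' : bilin phi ->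
  decomp X l -> decomp Y l' -> (forall x, Z x = a *: X x + Y x) ->
  tensor_form phi Z = a * tensor_form phi X + tensor_form phi Y.
Proof.
move=> bphi Xl Yl' ZE.
have Zl : decomp Z ([seq (a *: p.1, p.2) | p <- l] ++ l').
  by move=> x; rewrite ZE; apply: (decompD (decompZ a Xl) Yl').
rewrite (tensor_formE bphi Zl) (tensor_formE bphi Xl) (tensor_formE bphi Yl').
rewrite big_cat big_map /= mulr_sumr; congr (_ + _); apply: eq_bigr => p _.
by rewrite (linear_funZ (bilinl bphi _)).
Qed.

End Tensors.

(** Coordinates in a free family are unique, hence linear in the argument of [X]. *)
Lemma finite_rank_decomp (K : fieldType) (E : lmodType K) (S : set E) (X : E -> E) :
  finite_dim S -> linear X -> (forall x, S (X x)) ->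
  exists l, decomp (@dual_ev K E) X l.
Proof.
move=> /finite_dim_basis[d [b [Sb gen fr]]] lX SX.
have /choice[c cE] : forall x, exists c : 'I_d -> K, X x = \sum_i c i *: b i.
  by move=> x; apply: gen.
have lc i : linear (fun x => c x i : K^o).
  move=> a u v; apply/eqP; rewrite -subr_eq0; apply/eqP.
  have F : \sum_i (c (a *: u + v) i - (a * c u i + c v i)) *: b i = 0.
    under eq_bigr do rewrite scalerBl scalerDl -scalerA.
    by rewrite sumrB -cE big_split /= -scaler_sumr -!cE lX subrr.
  exact: (fr _ F i).
exists [seq (b i, mkdual (lc i)) | i <- enum 'I_d] => x.
by rewrite big_map big_enum cE.
Qed.

(** * Group algebra: Schur's lemma and density *)

Section GroupAlgebra.
Variables (R : realType) (G : groupType) (E : lmodType R[i]).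
Variable pi : representation G E.

(* The element sum_i c_i g_i of the group algebra is the list of the (c_i, g_i). *)
Definition act (a : seq (R[i] * G)) (v : E) : E := \sum_(p <- a) p.1 *: pi p.2 v.

Lemma act_linear a : linear (act a).
Proof.
move=> c u v; rewrite /act scaler_sumr -big_split; apply: eq_bigr => p _ /=.
by rewrite linearP scalerDr !scalerA mulrC.
Qed.

Definition act_mul (a b : seq (R[i] * G)) : seq (R[i] * G) :=
  [seq (p.1 * q.1, (p.2 * q.2)%g) | p <- a, q <- b].

Lemma actM a b v : act (act_mul a b) v = act a (act b v).
Proof.
rewrite /act big_allpairs_dep; apply: eq_bigr => p _.
rewrite linear_sum scaler_sumr; apply: eq_bigr => q _ /=.
by rewrite repM linearZ scalerA.
Qed.

Definition act_scale c (a : seq (R[i] * G)) := [seq (c * p.1, p.2) | p <- a].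

Lemma actZ c a v : act (act_scale c a) v = c *: act a v.
Proof.
by rewrite /act big_map scaler_sumr; apply: eq_bigr => p _; rewrite scalerA.
Qed.

Lemma act_cat a b v : act (a ++ b) v = act a v + act b v.
Proof. by rewrite /act big_cat. Qed.

Lemma act1 g v : act [:: (1, g)] v = pi g v.
Proof. by rewrite /act big_seq1 scale1r. Qed.

Hypothesis irr : rep_irreducible pi.

Lemma irreducible_set (S : set E) :
  (forall c u v, S u -> S v -> S (c *: u + v)) ->
  (forall g v, S v -> S (pi g v)) ->
  (exists2 v, S v & v != 0) -> forall v, S v.
Proof.
move=> Slin Sg [v Sv v0].
have [||E0|ET] := (irr.2 (fun v => `[< S v >])).
- split=> [|c x y /asboolP Sx /asboolP Sy]; apply/asboolP; last exact: Slin.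
  by have := Slin (-1) v v Sv Sv; rewrite scaleN1r addNr.
- by move=> g w /asboolP Sw; apply/asboolP; apply: Sg.
- by have := E0 v; rewrite [LHS](asboolT Sv) inE (negbTE v0).
- by move=> w; apply/asboolP; exact: etrans (ET w) _.
Qed.

Lemma act_transitive v w : v != 0 -> exists a, act a v = w.
Proof.
move=> v0; apply: (@irreducible_set [set w | exists a, act a v = w]).
- move=> c x y [a <-] [b <-]; exists (act_scale c a ++ b).
  by rewrite act_cat actZ.
- move=> g x [a <-]; exists (act_mul [:: (1, g)] a).
  by rewrite actM act1.
- by exists v => //; exists [:: (1, 1%g)]; rewrite act1 rep1.
Qed.

Definition schur_rep := forall T : E -> E, linear T ->
  (forall g v, T (pi g v) = pi g (T v)) -> exists c, forall v, T v = c *: v.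

(** [T] has an eigenvector because it stabilises the finite-dimensional [S], and the eigenspace is a
    nonzero subrepresentation. In use, [S] consists of the vectors fixed by a compact open
    subgroup. *)
Lemma schur (S : set E) : finite_dim S -> (exists2 v, S v & v != 0) ->
  (forall T : E -> E, linear T -> (forall g v, T (pi g v) = pi g (T v)) ->
     forall v, S v -> S (T v)) -> schur_rep.
Proof.
move=> fS nzS stS T lT cT.
have [v v0 [c Tv]] := eigenvector fS lT (stS T lT cT) nzS.
exists c; apply: (@irreducible_set [set v | T v = c *: v]).
- by move=> d x y /= Tx Ty; rewrite lT Tx Ty scalerDr !scalerA mulrC.
- by move=> g w /= Tw; rewrite cT Tw linearZ.
- by exists v.
Qed.

Hypothesis sch : schur_rep.

(** Jacobson density. Let [J] be the left ideal annihilating [s]. If every [a] in [J] killing [u]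
    also killed [v], then [act a u] |-> [act a v] would be a well-defined intertwiner, a scalar c by
    Schur. All of [J] would kill v - c u, which by induction puts it in the span of [s]. *)
Lemma density (s : seq E) v : ~ spanned s v ->
  exists a, (forall u, u \in s -> act a u = 0) /\ act a v != 0.
Proof.
elim: s v => [|u s IHs] v /= nsv.
  exists [:: (1, 1%g)]; split=> //; rewrite act1 rep1.
  by apply/negP => /eqP.
have [su|nsu] := pselect (spanned s u).
  have [|a [as0 av]] := IHs v.
    by move=> sv; apply: nsv; exists 0; rewrite scale0r subr0.
  exists a; split=> // w; rewrite inE => /orP[/eqP ->|]; last exact: as0.
  clear -su as0; elim: s u su as0 => [|x s' IH] y /=; first by move=> -> _; apply: linear_fun0 (act_linear a).
  move=> [c /IH sy] as0; apply/eqP; rewrite -[y](subrK (c *: x)).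
  rewrite (linear_funD (act_linear a)) sy => [|z zs]; last by apply: as0; rewrite inE zs orbT.
  by rewrite add0r (linear_funZ (act_linear a)) as0 ?mem_head ?scaler0.
apply: contrapT => nex.
pose J a := forall x, x \in s -> act a x = 0.
have Jv a : J a -> act a u = 0 -> act a v = 0.
  move=> Ja au; apply: contrapT => /eqP av; apply: nex; exists a; split=> // w.
  by rewrite inE => /orP[/eqP -> //|]; apply: Ja.
have Jl b a : J a -> J (act_mul b a).
  by move=> Ja x xs; rewrite actM Ja // (linear_fun0 (act_linear b)).
have Jc c a b : J a -> J b -> J (act_scale c a ++ b).
  by move=> Ja Jb x xs; rewrite act_cat actZ Ja // Jb // scaler0 addr0.
(* Some element of [J] does not kill [u]; irreducibility then carries [u] anywhere within the left
   ideal. *)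
have Ju w : exists a, J a /\ act a u = w.
  have [a0 [a0s a0u]] := IHs u nsu; have [b bE] := act_transitive w a0u.
  by exists (act_mul b a0); split; [apply: Jl|rewrite actM].
have /choice[k kP] := Ju.
pose T w := act (k w) v.
have TE a : J a -> T (act a u) = act a v.
  move=> Ja; have [Jk ku] := kP (act a u); apply/eqP; rewrite -subr_eq0.
  have := Jv (act_scale (-1) a ++ k (act a u)) (Jc _ _ _ Ja Jk).
  rewrite !act_cat !actZ ku !scaleN1r addNr => /(_ erefl)/eqP.
  by rewrite addrC.
have [c Tc] : exists c, forall w, T w = c *: w.
  apply: sch => [c x y|g w].
    have [Jx xE] := kP x; have [Jy yE] := kP y.
    have := TE _ (Jc c _ _ Jx Jy).
    by rewrite !act_cat !actZ xE yE.
  have [Jw wE] := kP w; have := TE _ (Jl [:: (1, g)] _ Jw).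
  by rewrite !actM !act1 wE.
have [a [Ja]] : exists a, J a /\ act a (v - c *: u) != 0.
  by apply: IHs => sv; apply: nsv; exists c.
rewrite (linear_funB (act_linear a)) (linear_funZ (act_linear a)) -Tc TE //.
by rewrite subrr eqxx.
Qed.

Lemma bilin_act (M : lmodType R[i]) (ev : M -> E -> R[i]^o) a :
  bilin ev -> bilin (fun v m => ev m (act a v)).
Proof.
move=> evb; split=> [m|v] c x y; last exact: (bilinl evb).
by rewrite act_linear (bilinr evb).
Qed.

(* The trace pairing of the group algebra with finite rank operators is
   non-degenerate. *)
Lemma tensor_eq0_act (M Z : lmodType R[i]) (ev : M -> E -> R[i]^o)
    (phi : E -> M -> Z) l :
  bilin ev -> (forall m, (forall x, ev m x = 0) -> m = 0) -> bilin phi ->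
  (forall a, \sum_(p <- l) ev p.2 (act a p.1) = 0) ->
  \sum_(p <- l) phi p.1 p.2 = 0.
Proof.
move=> evb ev_inj bphi.
have [n] := ubnP (size l); elim: n l => // n IHn [|[v m] l] /=; first by rewrite big_nil.
rewrite ltnS => szl Hl.
have [sv|nsv] := pselect (spanned (unzip1 l) v).
  have [l' [szl' El']] := tensor_absorb m sv.
  rewrite El' //; apply: IHn; first by rewrite szl'.
  by move=> a; rewrite -(El' _ _ (bilin_act a evb)).
have [a0 [a0s a0v]] := density nsv.
have kill b p : p \in l -> act (act_mul b a0) p.1 = 0.
  by move=> pl; rewrite actM a0s ?map_f // (linear_fun0 (act_linear b)).
have m0 : m = 0.
  apply: ev_inj => x; have [b <-] := act_transitive x a0v.
  have := Hl (act_mul b a0); rewrite big_cons /= big_seq big1 ?addr0 ?actM //.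
  by move=> p /kill ->; rewrite (linear_fun0 (bilinr evb _)).
rewrite big_cons /= m0 (linear_fun0 (bilinr bphi v)) add0r; apply: IHn => // a.
by have := Hl a; rewrite big_cons /= m0 (linear_fun0 (bilinl evb _)) add0r.
Qed.

(** Shorten the list until the leading vector is independent of the others and its form is nonzero;
    density then kills all other terms. *)
Lemma rank_one_multiple (M : lmodType R[i]) (ev : M -> E -> R[i]^o) X l :
  bilin ev -> decomp ev X l -> (exists x, X x != 0) ->
  exists a v m, [/\ v != 0, exists x, ev m x != 0 & forall x, act a (X x) = ev m x *: v].
Proof.
move=> evb.
have [n] := ubnP (size l); elim: n l => // n IHn [|[v m] l] /=.
  by move=> _ Xl [x]; rewrite Xl big_nil eqxx.
rewrite ltnS => szl Xl nzX.
have [sv|nsv] := pselect (spanned (unzip1 l) v).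
  have [l' [szl' El']] := tensor_absorb m sv.
  apply: (IHn l') => //; first by rewrite szl'.
  by move=> x; rewrite -(El' _ _ (bilin_ev_op evb x)) -Xl.
have [m0|/existsNP[x /eqP mx]] := pselect (forall x, ev m x = 0).
  by apply: (IHn l) => // x; rewrite Xl big_cons m0 scale0r add0r.
have [a0 [a0s a0v]] := density nsv.
exists a0, (act a0 v), m; split=> //; first by exists x.
move=> y; rewrite Xl big_cons /= act_linear (linear_fun_sumZ (act_linear a0)).
rewrite big_seq big1 ?addr0 // => p pl.
by rewrite a0s ?scaler0 ?map_f.
Qed.

End GroupAlgebra.

(** * Haar integral along a chain of compact open subgroups *)

(** What integration needs to know about principal congruence subgroups. [chain_conj] stands for
    continuity of conjugation and [chain_fin] for compactness. *)
Record subgroup_chain (G : groupType) (Kc : nat -> set G) : Prop := SubgroupChain {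
  chain1 : forall m, Kc m 1%g;
  chainM : forall m x y, Kc m x -> Kc m y -> Kc m (x * y)%g;
  chainV : forall m x, Kc m x -> Kc m x^-1%g;
  chain_mono : forall m m' x, (m <= m')%N -> Kc m' x -> Kc m x;
  chain_conj : forall g m, exists m', forall k, Kc m' k -> Kc m (g * k * g^-1)%g;
  chain_fin : forall m m', exists s : seq G,
    forall x, Kc m x -> exists2 y, y \in s & Kc m' (y^-1 * x)%g
}.

Section Haar.
Variables (G : groupType) (Kc : nat -> set G).
Hypothesis ch : subgroup_chain Kc.

Definition covers (s : seq G) m (A : set G) :=
  forall x, A x -> exists2 y, y \in s & Kc m (y^-1 * x)%g.

Definition rinv (T : Type) m (phi : G -> T) :=
  forall x k, Kc m k -> phi (x * k)%g = phi x.

Definition transv m (s : seq G) : bool :=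
  pairwise (fun x y => `[< ~ Kc m (x^-1 * y)%g >]) s.

Lemma chain_sym m x y : Kc m (x^-1 * y)%g -> Kc m (y^-1 * x)%g.
Proof. by move/(chainV ch); rewrite invgM invgK. Qed.

Lemma chain_trans m x y z : Kc m (x^-1 * y)%g -> Kc m (y^-1 * z)%g -> Kc m (x^-1 * z)%g.
Proof. by move=> xy yz; have := chainM ch xy yz; rewrite mulgA mulgK. Qed.

Lemma rinvP (T : Type) m (phi : G -> T) x y :
  rinv m phi -> Kc m (x^-1 * y)%g -> phi y = phi x.
Proof. by move=> rphi /(rphi x); rewrite mulVKg. Qed.

Lemma rinv_mono (T : Type) m m' (phi : G -> T) : (m <= m')%N -> rinv m phi -> rinv m' phi.
Proof. by move=> mm' rphi x k /(chain_mono ch mm')/rphi. Qed.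

(** [A] is quantified last so that one sublist serves two supports at once in [Step_common]. *)
Lemma transversal_sub m (s : seq G) : exists s', [/\ transv m s', {subset s' <= s} &
  forall A, covers s m A -> covers s' m A].
Proof.
elim: s => [|x s [s' [ts' ss' cs']]]; first by exists [::].
have {}cs' w z : w \in s -> Kc m (w^-1 * z)%g -> exists2 y, y \in s' & Kc m (y^-1 * z)%g.
  by move=> ws wz; apply: (cs' (fun z => Kc m (w^-1 * z)%g)) => // u wu; exists w.
have [[y ys' yx]|ny] := pselect (exists2 y, y \in s' & Kc m (y^-1 * x)%g).
  exists s'; split=> // [z /ss' zs|A cA]; first by rewrite inE zs orbT.
  move=> z /cA[w]; rewrite inE => /orP[/eqP ->|ws]; last exact: cs'.
  by move=> wz; exists y => //; apply: chain_trans yx wz.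
exists (x :: s'); split.
- rewrite /transv /= -/(transv m s') ts' andbT; apply/allP => y ys'; apply/asboolP.
  by move=> /chain_sym xy; apply: ny; exists y.
- by move=> z; rewrite !inE => /orP[->//|/ss' ->]; rewrite orbT.
- move=> A cA z /cA[w]; rewrite inE => /orP[/eqP ->|ws] wz.
    by exists x; rewrite ?mem_head.
  by have [y ys' yz] := cs' _ _ ws wz; exists y; rewrite ?inE ?ys' ?orbT.
Qed.

Lemma transv_sum1 (Z : nmodType) m s x (a : Z) : transv m s ->
  (exists2 y, y \in s & Kc m (y^-1 * x)%g) ->
  \sum_(y <- s) (if `[< Kc m (y^-1 * x)%g >] then a else 0) = a.
Proof.
elim: s => [|y s IHs] /=; first by move=> _ [].
move=> /andP[/allP ns ts] [y0]; rewrite inE big_cons => y0s y0x.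
case: asboolP => [yx|nyx].
  rewrite big_seq big1 ?addr0 // => z /ns/asboolP nyz; case: asboolP => // zx.
  by case: nyz; apply: chain_trans yx (chain_sym zx).
rewrite add0r IHs //; exists y0 => //; case/orP: y0s => // /eqP y0y.
by rewrite y0y in y0x.
Qed.

(** Double counting: each value is expanded over the representatives of its coset in the other list,
    and the sums are exchanged. *)
Lemma transv_sum_uniq (Z : nmodType) m s s' (phi : G -> Z) : rinv m phi ->
  transv m s -> transv m s' ->
  covers s m [set x | phi x != 0] -> covers s' m [set x | phi x != 0] ->
  \sum_(x <- s) phi x = \sum_(x <- s') phi x.
Proof.
move=> rphi ts ts' cs cs'.
have one r x : transv m r -> covers r m [set x | phi x != 0] ->
    phi x = \sum_(y <- r) (if `[< Kc m (y^-1 * x)%g >] then phi x else 0).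
  move=> tr cr; have [px0|/cr ex] := eqVneq (phi x) 0; last by rewrite transv_sum1.
  by rewrite px0 big1 // => y _; case: ifP.
rewrite (eq_bigr _ (fun x _ => one _ x ts' cs')) exchange_big /=.
apply: eq_bigr => y _; rewrite [RHS](one _ y ts cs); apply: eq_bigr => x _.
case: asboolP => [yx|nyx]; case: asboolP => [xy|nxy] //; last 1 first.
- by case: nyx; apply: chain_sym.
- exact: rinvP yx.
- by case: nxy; apply: chain_sym.
Qed.

Definition is_reps m m' (s : seq G) :=
  [/\ transv m' s, forall x, x \in s -> Kc m x & covers s m' (Kc m)].

Lemma reps_ex m m' : (m <= m')%N -> exists s, is_reps m m' s.
Proof.
move=> mm'; have [s sP] := chain_fin ch m m'.
have [s' [ts' ss' cs']] := transversal_sub m' [seq x <- s | `[< Kc m x >]].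
exists s'; split=> //.
  by move=> x /ss'; rewrite mem_filter => /andP[/asboolP].
apply: cs' => x Kx; have [y ys yx] := sP _ Kx; exists y => //.
rewrite mem_filter ys andbT; apply/asboolP.
have := chainM ch Kx (chain_mono ch mm' (chain_sym yx)).
by rewrite mulVKg.
Qed.

Definition reps m m' : seq G := xget [::] [set s | is_reps m m' s].

Lemma repsP m m' : (m <= m')%N -> is_reps m m' (reps m m').
Proof. by move=> /reps_ex; apply: xgetPex. Qed.

(** The index is well defined: [transv_sum_uniq] is applied to the integer-valued indicator of
    [Kc m]. *)
Lemma reps_size m m' s : (m <= m')%N -> is_reps m m' s -> size s = size (reps m m').
Proof.
move=> mm' [ts Ks cs]; have [tr Kr cr] := repsP mm'.
pose phi x : int := if `[< Kc m x >] then 1 else 0.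
have sphi r : (forall x, x \in r -> Kc m x) -> \sum_(x <- r) phi x = (size r)%:R.
  move=> Kr'; rewrite big_seq; under eq_bigr => x /Kr' Kx.
    by rewrite /phi asboolT //; over.
  by rewrite -big_seq big_const_seq count_predT iter_addr_0.
have supp x : phi x != 0 -> Kc m x by rewrite /phi; case: asboolP.
apply/eqP; rewrite -(eqr_nat int) -!sphi //; apply/eqP.
apply: (transv_sum_uniq (m := m')) => // [x k Kk||]; last 2 first.
- by move=> x /supp/cs.
- by move=> x /supp/cr.
congr (if _ then _ else _); apply/asboolP/asboolP => Kx.
  by rewrite -(mulgK k x); apply: chainM => //; apply/(chainV ch)/(chain_mono ch mm').
by apply: chainM => //; apply: chain_mono Kk.
Qed.

Lemma transv_allpairs m m' s : (m <= m')%N -> transv m s ->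
  transv m' [seq (x * y)%g | x <- s, y <- reps m m'].
Proof.
move=> mm'; have [tr Kr _] := repsP mm'.
elim: s => //= x s IHs /andP[/allP xs ts].
rewrite /transv pairwise_cat; have := IHs ts; rewrite /transv => ->.
rewrite andbT; apply/andP; split.
  apply/allrelP => _ _ /mapP[y yr ->] /allpairsP[[z w] /= [zs wr ->]].
  apply/asboolP => Kxyzw; have /asboolP := xs _ zs; apply.
  have := chain_mono ch mm' Kxyzw.
  move/(chainM ch (Kr _ yr))/(chainM ch)/(_ (chainV ch (Kr _ wr))).
  by rewrite invgM !mulgA mulgV mul1g mulgK.
rewrite pairwise_map; apply: sub_pairwise tr => y w /= /asboolP nyw.
by apply/asboolP; rewrite invgM mulgA mulgVK.
Qed.

Lemma covers_allpairs m m' s A : (m <= m')%N -> covers s m A ->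
  covers [seq (x * y)%g | x <- s, y <- reps m m'] m' A.
Proof.
move=> mm' cs x /cs[y ys yx]; have [_ _ cr] := repsP mm'.
have [z zr zyx] := cr _ yx; exists (y * z)%g; first exact: allpairs_f.
by rewrite invgM -mulgA.
Qed.

(** The index of [Kc m] in [Kc 0], so the inverse volume of [Kc m] when [Kc 0] has volume 1. *)
Definition chain_index m := size (reps 0 m).

Lemma chain_indexM m m' : (m <= m')%N -> chain_index m' = (chain_index m * size (reps m m'))%N.
Proof.
move=> mm'; rewrite /chain_index -(size_allpairs (fun x y : G => (x * y)%g)); apply/esym/reps_size => //.
have [t K c] := repsP (leq0n m); have [_ Km _] := repsP mm'; split.
- exact: transv_allpairs.
- move=> _ /allpairsP[[x y] /= [xs yr ->]]; apply: (chainM ch); first exact: K.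
  by apply: (chain_mono ch (leq0n m)); apply: Km.
- exact: covers_allpairs.
Qed.

Lemma chain_index_neq0 (K : numFieldType) m : (chain_index m)%:R != 0 :> K.
Proof.
rewrite pnatr_eq0 /chain_index size_eq0; apply/eqP => r0.
by have [_ _] := repsP (leq0n m); rewrite r0 => /(_ 1%g (chain1 ch 0)) [y]; rewrite in_nil.
Qed.

Lemma chain_index0 : chain_index 0 = 1.
Proof.
apply/esym/(@reps_size 0 0 [:: 1%g]) => //; split=> //.
  by move=> x; rewrite inE => /eqP ->; apply: chain1.
by move=> x Kx; exists 1%g; rewrite ?mem_head // invg1 mul1g.
Qed.

(** Local constancy and compact support in terms of cosets; for complex values [schwartz_Step] and
    [Step_schwartz] identify these functions with S(G). *)
Definition step (Z : nmodType) m (phi : G -> Z) :=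
  rinv m phi /\ exists s, covers s m [set x | phi x != 0].

Definition Step (Z : nmodType) (phi : G -> Z) := exists m, step m phi.

Lemma step_mono (Z : nmodType) m m' (phi : G -> Z) :
  (m <= m')%N -> step m phi -> step m' phi.
Proof.
move=> mm' [r [s cs]]; split; first exact: rinv_mono r.
by eexists; apply: covers_allpairs cs.
Qed.

Lemma Step_common (Z Z' : nmodType) (phi : G -> Z) (psi : G -> Z') :
  Step phi -> Step psi -> exists m s,
    [/\ rinv m phi, rinv m psi, transv m s,
       covers s m [set x | phi x != 0] & covers s m [set x | psi x != 0]].
Proof.
move=> [m1 /(step_mono (leq_maxl m1 _)) s1] [m2 /(step_mono (leq_maxr m1 m2)) s2].
have [r1 [t1 c1]] := s1 m2; have [r2 [t2 c2]] := s2.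
have [s [ts _ cs]] := transversal_sub (maxn m1 m2) (t1 ++ t2).
exists (maxn m1 m2), s; split=> //; apply: cs.
  by move=> x /c1[y yt yx]; exists y; rewrite // mem_cat yt.
by move=> x /c2[y yt yx]; exists y; rewrite // mem_cat yt orbT.
Qed.

Lemma Step_transversal (Z : nmodType) (phi : G -> Z) : Step phi ->
  exists m s, [/\ rinv m phi, transv m s & covers s m [set x | phi x != 0]].
Proof. by move=> Sphi; have [m [s []]] := Step_common Sphi Sphi; exists m, s. Qed.

Lemma Step_comp2 (Z1 Z2 Z : nmodType) (phi : G -> Z1) (psi : G -> Z2) (F : Z1 -> Z2 -> Z) :
  F 0 0 = 0 -> Step phi -> Step psi -> Step (fun x => F (phi x) (psi x)).
Proof.
move=> F0 Sphi Spsi; have [m [s [r1 r2 ts c1 c2]]] := Step_common Sphi Spsi.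
exists m; split=> [x k Kk|]; first by rewrite r1 // r2.
exists s => x /=; have [p0|/c1//] := eqVneq (phi x) 0.
by have [q0|/c2//] := eqVneq (psi x) 0; rewrite p0 q0 F0 eqxx.
Qed.

Lemma Step_comp (Z1 Z : nmodType) (phi : G -> Z1) (F : Z1 -> Z) :
  F 0 = 0 -> Step phi -> Step (F \o phi).
Proof. by move=> F0 Sphi; exact: (Step_comp2 (F := fun a _ => F a) F0 Sphi Sphi). Qed.

Lemma Step_left (Z : nmodType) (phi : G -> Z) g : Step phi -> Step (fun x => phi (g * x)%g).
Proof.
move=> [m [r [s cs]]]; exists m; split=> [x k Kk|]; first by rewrite mulgA; apply: r.
exists [seq (g^-1 * y)%g | y <- s] => x /cs[y ys yx]; exists (g^-1 * y)%g.
  exact: map_f.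
by rewrite invgM invgK -mulgA.
Qed.

Lemma conj_covers g m m' : exists s, covers s m' [set x | Kc m (g^-1 * x * g)%g].
Proof.
have [p pP] := chain_conj ch g m'; have [t tP] := chain_fin ch m p.
exists [seq (g * y * g^-1)%g | y <- t] => x /tP[y yt /pP].
rewrite !mulgA mulgK => Kx; exists (g * y * g^-1)%g; first exact: map_f.
by rewrite !invgM invgK !mulgA.
Qed.

Lemma Step_right (Z : nmodType) (phi : G -> Z) g : Step phi -> Step (fun x => phi (x * g)%g).
Proof.
move=> [m [r [s cs]]]; have [m' m'P] := chain_conj ch g^-1 m.
have [t tP] := conj_covers g m m'; exists m'; split=> [x k /m'P|].
  by rewrite invgK => Kk; rewrite -(r (x * g)%g _ Kk) !mulgA mulgK.
exists [seq (y * g^-1 * z)%g | y <- s, z <- t] => x /cs[y ys yx].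
have [|z zt zx] := tP (g * y^-1 * x)%g; first by rewrite /= !mulgA mulVg mul1g -mulgA.
exists (y * g^-1 * z)%g; first exact: allpairs_f.
by rewrite !invgM invgK -!mulgA; rewrite -!mulgA in zx.
Qed.

(** The support lies in finitely many cosets y [Kc m], and one [Kc m'] satisfies y^-1 [Kc m'] y <=
    [Kc m] for all these y; hence [phi] is left invariant under [Kc m']. *)
Lemma Step_inv (Z : nmodType) (phi : G -> Z) : Step phi -> Step (fun x => phi x^-1%g).
Proof.
move=> [m [r [s cs]]].
have [m' m'P] : exists m', forall y k, y \in s -> Kc m' k -> Kc m (y^-1 * k * y)%g.
  elim: (s) => [|y s' [p pP]]; first by exists 0.
  have [q qP] := chain_conj ch y^-1 m; exists (maxn p q) => z k.
  rewrite inE => /orP[/eqP ->|zs] Kk; last by apply: pP (chain_mono ch _ Kk); rewrite ?leq_maxl.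
  by have := qP k (chain_mono ch (leq_maxr _ _) Kk); rewrite invgK.
have /choice[t tP] := fun y => conj_covers y m m'.
have linv k z : Kc m' k -> phi z != 0 -> phi (k * z)%g = phi z.
  move=> Kk /cs[y ys yz]; rewrite (rinvP r yz); apply: (rinvP r).
  have := chainM ch (m'P _ _ ys Kk) yz; rewrite !mulgA; congr (Kc m _).
  by rewrite -!mulgA mulVKg.
exists m'; split=> [x k Kk|].
  rewrite invgM; have [p0|] := eqVneq (phi x^-1%g) 0; last exact: linv (chainV ch Kk).
  rewrite p0; apply: contrapT => /eqP p1.
  by have := linv _ _ Kk p1; rewrite mulVKg p0 => p2; rewrite -p2 eqxx in p1.
(* If x^-1 is in y [Kc m], then x is in y^-1 (y [Kc m] y^-1), and [t y] covers this conjugate. *)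
exists [seq (y^-1 * z)%g | y <- s, z <- t y] => x /cs[y ys yx].
have [|z zt zx] := tP y (y * x)%g.
  by apply: (eq_ind _ _ (chainV ch yx)); rewrite invgM !invgK !mulgA mulVg mul1g.
exists (y^-1 * z)%g; last by rewrite invgM invgK -mulgA.
by apply/allpairsPdep; exists y, z.
Qed.

(** * The integral and the modular character *)

Section Integral.
Variable K : numFieldType.

(** Values lie in any module so that pi(f) v is itself an integral. Functions that are not [Step]
    get 0. *)
Definition haar (E : lmodType K) (phi : G -> E) : E := xget 0
  [set v | exists m s, [/\ rinv m phi, transv m s, covers s m [set x | phi x != 0] &
     v = (chain_index m)%:R^-1 *: \sum_(x <- s) phi x]].

(** Each coset of [Kc m] splits into the same number of cosets of [Kc m'], the ratio of the two
    indices. *)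
Lemma haar_refine (E : lmodType K) (phi : G -> E) m m' s s' : (m <= m')%N ->
  rinv m phi -> transv m s -> covers s m [set x | phi x != 0] ->
  transv m' s' -> covers s' m' [set x | phi x != 0] ->
  (chain_index m)%:R^-1 *: \sum_(x <- s) phi x = (chain_index m')%:R^-1 *: \sum_(x <- s') phi x.
Proof.
move=> mm' r ts cs ts' cs'; rewrite (chain_indexM mm').
rewrite (transv_sum_uniq (rinv_mono mm' r) ts' (transv_allpairs mm' ts) cs'); last first.
  exact: covers_allpairs.
rewrite big_allpairs_dep /=.
have [_ Kr _] := repsP mm'.
have -> : \sum_(x <- s) \sum_(y <- reps m m') phi (x * y)%g =
    (size (reps m m'))%:R *: \sum_(x <- s) phi x.
  rewrite scaler_sumr; apply: eq_bigr => x _; rewrite big_seq.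
  under eq_bigr => y /Kr Ky do rewrite r //.
  by rewrite -big_seq big_const_seq count_predT iter_addr_0 scaler_nat.
have : (size (reps m m'))%:R != 0 :> K.
  by have := chain_index_neq0 K m'; rewrite (chain_indexM mm') natrM mulf_eq0 => /norP[].
by move=> r0; rewrite scalerA natrM invfM mulfVK // mulrC mulrA mulfV ?mul1r.
Qed.

Lemma haarE (E : lmodType K) (phi : G -> E) m s :
  rinv m phi -> transv m s -> covers s m [set x | phi x != 0] ->
  haar phi = (chain_index m)%:R^-1 *: \sum_(x <- s) phi x.
Proof.
move=> r ts cs; rewrite /haar; case: xgetP => [v _ [m' [s' [r' ts' cs' ->]]]|].
  have [mm'|/ltnW mm'] := leqP m' m; first exact: haar_refine.
  by apply/esym/haar_refine.
by move/(_ ((chain_index m)%:R^-1 *: \sum_(x <- s) phi x)); case; exists m, s.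
Qed.

Lemma haar_comb (E : lmodType K) (a : K) (phi psi : G -> E) : Step phi -> Step psi ->
  haar (fun x => a *: phi x + psi x) = a *: haar phi + haar psi.
Proof.
move=> Sphi Spsi; have [m [s [r1 r2 ts c1 c2]]] := Step_common Sphi Spsi.
rewrite (haarE r1 ts c1) (haarE r2 ts c2) (@haarE _ _ m s) //.
- by rewrite big_split /= -scaler_sumr scalerDr !scalerA mulrC.
- by move=> x k Kk; rewrite r1 // r2.
move=> x /=; have [p0|/c1//] := eqVneq (phi x) 0.
by have [q0|/c2//] := eqVneq (psi x) 0; rewrite p0 q0 scaler0 addr0 eqxx.
Qed.

Lemma haar_linear (E E' : lmodType K) (L : E -> E') (phi : G -> E) : linear L ->
  Step phi -> haar (fun x => L (phi x)) = L (haar phi).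
Proof.
move=> lL /Step_transversal[m [s [r ts cs]]].
rewrite (haarE r ts cs) (@haarE _ _ m s) ?(linear_funZ lL) ?(linear_fun_sum lL) //.
  by move=> x k Kk; rewrite r.
by move=> x /= Lx; apply: cs; apply: contra_neq Lx => /= ->; apply: linear_fun0.
Qed.

Lemma haar_left (E : lmodType K) (phi : G -> E) g : Step phi ->
  haar (fun x => phi (g * x)%g) = haar phi.
Proof.
move=> /Step_transversal[m [s [r ts cs]]].
rewrite (haarE r ts cs) (@haarE _ _ m [seq (g^-1 * y)%g | y <- s]).
- by rewrite big_map; under eq_bigr do rewrite mulVKg.
- by move=> x k Kk; rewrite mulgA; apply: r.
- rewrite /transv pairwise_map; apply: sub_pairwise ts => x y /=.
  by rewrite invgM invgK -mulgA mulVKg.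
move=> x /cs[y ys yx]; exists (g^-1 * y)%g; first exact: map_f.
by rewrite invgM invgK -mulgA.
Qed.

Definition ind (E : lmodType K) m (v : E) (x : G) : E := if `[< Kc m x >] then v else 0.

Lemma ind_rinv (E : lmodType K) m (v : E) : rinv m (ind m v).
Proof.
move=> x k Kk; congr (if _ then _ else _); apply/asboolP/asboolP => Kx.
  by rewrite -(mulgK k x); apply/(chainM ch)/(chainV ch).
exact: chainM.
Qed.

Lemma ind_covers (E : lmodType K) m (v : E) : covers [:: 1%g] m [set x | ind m v x != 0].
Proof.
move=> x /=; rewrite /ind; case: asboolP => [Kx _|]; last by rewrite eqxx.
by exists 1%g; rewrite ?mem_head // invg1 mul1g.
Qed.

Lemma Step_ind (E : lmodType K) m (v : E) : Step (ind m v).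
Proof. by exists m; split; [exact: ind_rinv|exists [:: 1%g]; apply: ind_covers]. Qed.

Lemma haar_ind (E : lmodType K) m (v : E) : haar (ind m v) = (chain_index m)%:R^-1 *: v.
Proof.
rewrite (haarE (@ind_rinv _ m v) _ (@ind_covers _ m v)) // big_seq1.
by rewrite /ind asboolT //; apply: chain1.
Qed.

Lemma ind_scale (E : lmodType K) m (v : E) x : ind m v x = (ind m (1 : K^o) x : K) *: v.
Proof. by rewrite /ind; case: ifP; rewrite ?scale1r ?scale0r. Qed.

Lemma sum_ind (E : lmodType K) (phi : G -> E) m s x :
  rinv m phi -> transv m s -> covers s m [set x | phi x != 0] ->
  phi x = \sum_(y <- s) ind m (phi y) (y^-1 * x)%g.
Proof.
move=> r ts cs; have [p0|/cs ex] := eqVneq (phi x) 0.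
  rewrite p0 big1 // => y _; rewrite /ind; case: asboolP => // /(rinvP r) <-.
  by rewrite p0.
rewrite -[LHS](transv_sum1 (phi x) ts ex); apply: eq_bigr => y _; rewrite /ind.
by case: asboolP => // /(rinvP r) ->.
Qed.

(** [ind 0 v] is a sum of [chain_index m] left translates of [ind m v], so left invariance fixes [J]
    on the latter; every [Step] function is a finite sum of left translates of such indicators. *)
Lemma haar_uniq (E : lmodType K) (J : (G -> E) -> E) (c : K) :
  (forall a phi psi, Step phi -> Step psi ->
     J (fun x => a *: phi x + psi x) = a *: J phi + J psi) ->
  (forall g phi, Step phi -> J (fun x => phi (g * x)%g) = J phi) ->
  (forall v, J (ind 0 v) = c *: v) ->
  forall phi, Step phi -> J phi = c *: haar phi.
Proof.
move=> Jlin Jleft J0 phi.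
have JD (I : Type) (r : seq I) (F : I -> G -> E) : (forall i, Step (F i)) ->
    Step (fun x => \sum_(i <- r) F i x) /\
    J (fun x => \sum_(i <- r) F i x) = \sum_(i <- r) J (F i).
  move=> SF; elim: r => [|i r [SIH IH]].
    have S0 : Step (fun _ : G => 0 : E).
      by exists 0; split=> //; exists [::] => x /=; rewrite eqxx.
    have -> : (fun x => \sum_(i <- [::]) F i x) = (fun=> 0).
      by apply/funext => x; rewrite big_nil.
    split=> //; rewrite big_nil; have := Jlin (-1) _ _ S0 S0.
    rewrite [X in _ = X + _]scaleN1r addNr => J00.
    by apply: etrans J00; congr J; apply/funext => x; rewrite scaler0 addr0.
  have -> : (fun x => \sum_(j <- i :: r) F j x) =
      (fun x => 1 *: F i x + \sum_(j <- r) F j x).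
    by apply/funext => x; rewrite big_cons scale1r.
  split; first by apply: (Step_comp2 (F := fun a b => 1 *: a + b)); rewrite // scaler0 addr0.
  by rewrite Jlin // IH big_cons scale1r.
have Jm m v : J (ind m v) = (chain_index m)%:R^-1 *: (c *: v).
  have [tr Kr cr] := repsP (leq0n m).
  have := J0 v; have -> : ind 0 v = (fun x => \sum_(y <- reps 0 m) ind m v (y^-1 * x)%g).
    apply/funext => x; rewrite {1}/ind; case: asboolP => [/cr ex|nK].
      by rewrite -[LHS](transv_sum1 v tr ex).
    rewrite big_seq big1 // => y /Kr Ky; rewrite /ind; case: asboolP => // Kyx.
    case: nK; rewrite -(mulVKg y x); apply: (chainM ch Ky).
    by apply: chain_mono Kyx.
  have [|_ ->] := JD _ (reps 0 m) (fun y x => ind m v (y^-1 * x)%g).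
    by move=> y; apply/Step_left/Step_ind.
  rewrite (eq_bigr (fun=> J (ind m v))); last first.
    by move=> y _; apply: (Jleft y^-1%g); apply: Step_ind.
  rewrite big_const_seq count_predT iter_addr_0 -/(chain_index m) => <-.
  by rewrite -scaler_nat scalerA mulVf ?scale1r // chain_index_neq0.
move=> /Step_transversal[m [s [r ts cs]]]; rewrite (haarE r ts cs).
rewrite (_ : phi = fun x => \sum_(y <- s) ind m (phi y) (y^-1 * x)%g); last first.
  by apply/funext => x; apply: sum_ind.
have [|_ ->] := JD _ s (fun y x => ind m (phi y) (y^-1 * x)%g).
  by move=> y; apply/Step_left/Step_ind.
rewrite (eq_bigr (fun y => (chain_index m)%:R^-1 *: (c *: phi y))); last first.
  by move=> y _; rewrite -Jm; apply: (Jleft y^-1%g); apply: Step_ind.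
rewrite -!scaler_sumr !scalerA mulrC; congr (_ *: _).
apply: eq_big_seq => x xs.
rewrite -[LHS](transv_sum1 (m := m) (s := s) (x := x)) //; last first.
  by exists x; rewrite // mulVg; apply: chain1.
by apply: eq_bigr => y _; rewrite /ind; case: asboolP => // /(rinvP r) ->.
Qed.

(** The left Haar volume of [Kc 0] g^-1. *)
Definition modulus (g : G) : K^o := haar (fun x => ind 0 (1 : K^o) (x * g)%g).

Lemma haar_right_modulus (E : lmodType K) (phi : G -> E) g : Step phi ->
  haar (fun x => phi (x * g)%g) = (modulus g : K) *: haar phi.
Proof.
apply: (haar_uniq (J := fun phi => haar (fun x => phi (x * g)%g))).
- by move=> a p q Sp Sq; rewrite haar_comb //; apply: Step_right.
- move=> h p Sp; rewrite -[RHS](haar_left h); last exact: Step_right.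
  by congr haar; apply/funext => x; rewrite mulgA.
move=> v; rewrite /modulus -(haar_linear (L := fun c : K^o => (c : K) *: v)).
- by congr haar; apply/funext => x; rewrite ind_scale.
- by move=> a x y; rewrite scalerDl scalerA.
exact/Step_right/Step_ind.
Qed.

Lemma modulusM g h : modulus (g * h)%g = (modulus g : K) * (modulus h : K).
Proof.
rewrite {3}/modulus -[RHS](@haar_right_modulus K^o); last exact/Step_right/Step_ind.
by congr haar; apply/funext => x; rewrite mulgA.
Qed.

Lemma modulus1 : modulus 1%g = 1.
Proof.
have := haar_ind 0 (1 : K^o); rewrite chain_index0 invr1 scale1r; apply: etrans.
by congr haar; apply/funext => x; rewrite mulg1.
Qed.

Lemma modulus_ge0 g : 0 <= (modulus g : K).
Proof.
have [m [s [r ts cs]]] := Step_transversal (Step_right g (Step_ind 0 (1 : K^o))).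
rewrite /modulus (haarE r ts cs); apply: mulr_ge0; first by rewrite invr_ge0 ler0n.
by apply: sumr_ge0 => x _; rewrite /ind; case: ifP.
Qed.

Section AntiAutomorphism.
Variable t : G -> G.
Hypotheses (tM : forall x y, t (x * y)%g = (t y * t x)%g) (tK : involutive t).
Hypothesis tKc : forall m x, Kc m x -> Kc m (t x).

Lemma anti1 : t 1%g = 1%g.
Proof.
have := tM 1%g 1%g; rewrite mulg1 -{1}[t 1%g]mulg1 => /mulgI.
by move=> /esym.
Qed.

Lemma antiV x : t x^-1%g = (t x)^-1%g.
Proof. by apply/esym/mulg1_eq; rewrite -tM mulVg anti1. Qed.

Lemma Step_antiV (Z : nmodType) (phi : G -> Z) : Step phi -> Step (fun x => phi (t x)^-1%g).
Proof.
move=> [m [r [s cs]]]; exists m; split=> [x k Kk|].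
  by rewrite tM invgM; apply/r/(chainV ch)/tKc.
exists [seq (t y)^-1%g | y <- s] => x /cs[y ys yx]; exists (t y)^-1%g; first exact: map_f.
have := tKc (chainV ch yx).
by rewrite !(invgM, tM, antiV, invgK, tK).
Qed.

Lemma Step_anti (Z : nmodType) (phi : G -> Z) : Step phi -> Step (phi \o t).
Proof.
move=> /Step_inv/Step_antiV Sp; apply: (eq_ind _ _ Sp).
by apply/funext => x; rewrite /= invgK.
Qed.

Lemma ind_anti (E : lmodType K) m (v : E) x : ind m v (t x) = ind m v x.
Proof.
congr (if _ then _ else _); apply/asboolP/asboolP; last exact: tKc.
by move/tKc; rewrite tK.
Qed.

Lemma ind_inv (E : lmodType K) m (v : E) x : ind m v x^-1%g = ind m v x.
Proof.
congr (if _ then _ else _); apply/asboolP/asboolP; last exact: chainV.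
by move/(chainV ch); rewrite invgK.
Qed.

(** x |-> (t x)^-1 is an automorphism preserving [Kc 0], so the transported integral is left
    invariant with the same normalisation. *)
Lemma haar_antiV (E : lmodType K) (phi : G -> E) : Step phi ->
  haar (fun x => phi (t x)^-1%g) = haar phi.
Proof.
rewrite -[RHS]scale1r; apply: (haar_uniq (J := fun p => haar (fun x => p (t x)^-1%g))).
- by move=> a p q Sp Sq; rewrite haar_comb //; apply: Step_antiV.
- move=> g p Sp; rewrite -[RHS](haar_left (t g)^-1%g); last exact: Step_antiV.
  by congr haar; apply/funext => x; rewrite tM antiV tK invgM invgK.
move=> v; have -> : (fun x => ind 0 v (t x)^-1%g) = ind 0 v.
  by apply/funext => x; rewrite ind_inv ind_anti.
by rewrite haar_ind chain_index0 invr1.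
Qed.

(** The modulus is unchanged under the automorphism g |-> (t g)^-1, and it is multiplicative. *)
Lemma modulus_anti g : (modulus (t g) : K) * (modulus g : K) = 1.
Proof.
have -> : modulus g = modulus (t g)^-1%g.
  rewrite {2}/modulus -[RHS]haar_antiV; last exact/Step_right/Step_ind.
  congr haar; apply/funext => x.
  by rewrite /= -invgM -tM ind_inv ind_anti.
by rewrite -modulusM mulgV modulus1.
Qed.

Hypothesis unimodular : forall g, modulus g = 1.

Lemma haar_right (E : lmodType K) (phi : G -> E) g : Step phi ->
  haar (fun x => phi (x * g)%g) = haar phi.
Proof. by move=> Sp; rewrite haar_right_modulus // unimodular scale1r. Qed.

(** [t] exchanges left and right translations, so uniqueness is applied through right invariance. *)
Lemma haar_anti (E : lmodType K) (phi : G -> E) : Step phi -> haar (phi \o t) = haar phi.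
Proof.
rewrite -[RHS]scale1r; apply: (haar_uniq (J := fun p => haar (p \o t))).
- by move=> a p q Sp Sq; rewrite -haar_comb //; apply: Step_anti.
- move=> g p Sp; rewrite -[RHS](haar_right (t g)); last exact: Step_anti.
  by congr haar; apply/funext => x; rewrite /= tM tK.
move=> v; have -> : ind 0 v \o t = ind 0 v by apply/funext => x; rewrite /= ind_anti.
by rewrite haar_ind chain_index0 invr1.
Qed.

End AntiAutomorphism.

End Integral.

End Haar.

(** * Hecke operators and invariant forms *)

(** Otherwise the subsets of [A] avoiding finitely many [U y] generate a proper filter. At a cluster
    point p, the set avoiding [U p] would meet [U p]. *)
Lemma compact_finite_nbhs_cover (X : topologicalType) (A : set X) (U : X -> set X) :
  compact A -> (forall x, nbhs x (U x)) ->
  exists s : seq X, forall x, A x -> exists2 y, y \in s & U y x.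
Proof.
move=> cA nU; apply: contrapT => ncov.
pose B (s : seq X) := [set x | A x /\ forall y, y \in s -> ~ U y x].
have FB : Filter (filter_from setT B).
  apply: filter_from_filter; first by exists [::].
  move=> s1 s2 _ _; exists (s1 ++ s2) => // x [Ax nx].
  by split; split=> // y ys; apply: nx; rewrite mem_cat ys ?orbT.
have PB : ProperFilter (filter_from setT B).
  apply: filter_from_proper => // s _; apply: contrapT => nB; apply: ncov.
  exists s => x Ax; apply: contrapT => nx; apply: nB; exists x; split=> // y ys Uyx.
  by apply: nx; exists y.
have [|p [Ap]] := cA _ PB; first by exists [::] => // x [].
move=> /(_ (B [:: p]) (U p))[||x [[_ nx] Ux]].
- by exists [:: p].
- exact: nU.
- by apply: (nx p); rewrite ?mem_head.
Qed.

(** * Schwartz functions as step functions *)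

Section SchwartzStep.
Variables (R : realType) (G : preTopologicalGroupType) (Kc : nat -> set G).
Hypothesis ch : subgroup_chain Kc.
Hypothesis nbhsK : forall (x : G) (A : set G),
  nbhs x A <-> exists m, forall k, Kc m k -> A (x * k)%g.
Hypothesis cptK : forall m, compact (Kc m).

Lemma nbhs_coset m (x : G) : nbhs x [set y | Kc m (x^-1 * y)%g].
Proof. by apply/nbhsK; exists m => k Kk /=; rewrite mulKg. Qed.

(** Uniform local constancy: finitely many cosets of constancy cover the support, and the largest of
    their levels works everywhere. *)
Lemma schwartz_Step (f : schwartz R G) : Step Kc f.
Proof.
case: f => f /= /asboolP[lf cf].
have /choice[mu muP] : forall x, exists m, forall k, Kc m k -> f (x * k)%g = f x.
  by move=> x; apply/(nbhsK x [set y | f y = f x])/lf.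
have [s sP] := compact_finite_nbhs_cover cf (fun x => nbhs_coset (mu x) x).
have inS x : f x != 0 -> closure [set x | f x != 0] x by move=> fx; apply: subset_closure.
pose m := \max_(y <- s) mu y.
have rsupp x k : Kc m k -> f x != 0 -> f (x * k)%g = f x.
  move=> Kk /inS/sP[y ys yx].
  have Kk' : Kc (mu y) k by apply: chain_mono Kk => //; apply: leq_bigmax_seq.
  by rewrite -[in RHS](mulVKg y x) -[in LHS](mulVKg y x) -mulgA !muP //; apply: chainM.
exists m; split=> [x k Kk|].
  have [fx0|] := eqVneq (f x) 0; last exact: rsupp.
  have [-> //|fxk] := eqVneq (f (x * k)%g) 0.
  by rewrite -(rsupp _ _ (chainV ch Kk) fxk) mulgK.
have [s' s'P] := compact_finite_nbhs_cover cf (nbhs_coset m).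
by exists s' => x /inS/s'P.
Qed.

Lemma Step_schwartz (f : G -> R[i]) : Step Kc f -> f \in @schwartz_pred R G.
Proof.
move=> [m [r [s cs]]]; apply/asboolP; split=> [x|].
  by apply/nbhsK; exists m => k; apply: r.
pose U := \big[setU/set0]_(y <- s) ((fun x => y * x)%g @` Kc m).
have cU : compact U.
  rewrite /U; elim: s {cs U} => [|y s IHs]; first by rewrite big_nil; apply: compact0.
  rewrite big_cons; apply: compactU IHs.
  have cont : continuous (fun x : G => (y * x)%g).
    move=> x A nA; have [p pP] := (nbhsK _ _).1 nA.
    by apply/nbhsK; exists p => k Kk /=; rewrite mulgA; apply: pP.
  exact: (continuous_compact (continuous_subspaceT cont) (@cptK m)).
(* A point of the closure shares a coset of [Kc m] with a point of the support, hence lies in the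
   support. *)
apply: (subclosed_compact (@closed_closure _ _) cU) => x cx.
have [z [/= fz Kz]] := cx _ (nbhs_coset m x).
have : f x != 0 by rewrite -(rinvP r Kz).
move=> /cs[y ys yx]; rewrite /U -bigcup_seq; exists y => //.
by exists (y^-1 * x)%g => //; rewrite mulVKg.
Qed.

End SchwartzStep.

(** * Hecke operators and the distribution character *)

Section HeckeOperators.
Variables (R : realType) (G : groupType) (Kc : nat -> set G).
Hypothesis ch : subgroup_chain Kc.
Variables (E : lmodType R[i]) (pi : representation G E).
Hypothesis smooth_pi : forall v, exists m, forall k, Kc m k -> pi k v = v.
Hypothesis fixed_fin : forall m, finite_dim [set v | forall k, Kc m k -> pi k v = v].

Implicit Types f h : G -> R[i].

Local Notation haar := (@haar G Kc R[i]).
Local Notation ind1 m := (ind Kc m (1 : R[i]^o)).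

(* pi(f) in the usual notation. *)
Definition hop (f : G -> R[i]) (v : E) : E := haar (fun g => f g *: pi g v).

Lemma Step_hop f v : Step Kc f -> Step Kc (fun g => f g *: pi g v).
Proof.
move=> [m sf]; have [m' m'P] := smooth_pi v.
have [r [s cs]] := step_mono ch (leq_maxl m m') sf.
exists (maxn m m'); split=> [x k Kk|].
  by rewrite r // repM m'P //; apply: chain_mono Kk => //; apply: leq_maxr.
by exists s => x /= fx; apply: cs; apply: contra_neq fx => /= ->; rewrite scale0r.
Qed.

Lemma hop_linear f : Step Kc f -> linear (hop f).
Proof.
move=> Sf a u v; rewrite /hop -haar_comb //; try exact: Step_hop.
by congr haar; apply/funext => g; rewrite linearP scalerDr !scalerA mulrC.
Qed.

Lemma hop_comb a f h v : Step Kc f -> Step Kc h ->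
  hop (fun x => a * f x + h x) v = a *: hop f v + hop h v.
Proof.
move=> Sf Sh; rewrite /hop -haar_comb //; try exact: Step_hop.
by congr haar; apply/funext => g; rewrite scalerDl scalerA.
Qed.

Lemma hop_left f g v : Step Kc f -> hop (fun x => f (g^-1 * x)%g) v = pi g (hop f v).
Proof.
move=> Sf; rewrite /hop -[LHS](haar_left ch g); last first.
  exact: (Step_hop v (Step_left _ Sf)).
rewrite -(haar_linear ch (L := pi g)); first last.
- exact: Step_hop.
- exact: linearP.
by congr haar; apply/funext => x; rewrite mulKg repM linearZ.
Qed.

Lemma left_inv_Step f : Step Kc f ->
  exists m, forall k x, Kc m k -> f (k * x)%g = f x.
Proof.
move=> /(Step_inv ch)[m [r _]]; exists m => k x Kk.
by have := r x^-1%g _ (chainV ch Kk); rewrite invgM !invgK.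
Qed.

(** [f] is left invariant under some [Kc m], so the image of pi(f) consists of vectors fixed by
    [Kc m]: a finite-dimensional space by admissibility. *)
Lemma hop_decomp f : Step Kc f -> exists l, decomp (@dual_ev R[i] E) (hop f) l.
Proof.
move=> Sf; have [m mP] := left_inv_Step Sf.
apply: finite_rank_decomp (fixed_fin m) (hop_linear Sf) _ => v k Kk /=.
rewrite -hop_left //; congr hop; apply/funext => x.
by rewrite mP //; apply: chainV.
Qed.

Lemma hop_ind m v : (forall k, Kc m k -> pi k v = v) ->
  hop (ind1 m) v = (chain_index Kc m)%:R^-1 *: v.
Proof.
move=> mv; rewrite -(haar_ind ch); congr haar; apply/funext => x.
rewrite [RHS]ind_scale /ind; case: asboolP => [Kx|]; last by rewrite !scale0r.
by rewrite mv.
Qed.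

Definition lact (a : seq (R[i] * G)) (f : G -> R[i]) (x : G) : R[i] :=
  \sum_(p <- a) p.1 * f (p.2^-1 * x)%g.

Lemma lact_hop a f v : Step Kc f ->
  Step Kc (lact a f) /\ hop (lact a f) v = act pi a (hop f v).
Proof.
move=> Sf; elim: a => [|p a [SIH IH]].
  have -> : lact [::] f = fun=> 0 by apply/funext => x; rewrite /lact big_nil.
  split; first by exists 0; split=> //; exists [::] => x /=; rewrite eqxx.
  rewrite /act big_nil /hop.
  have -> : (fun g => 0 *: pi g v) = (fun g => 0 *: (f g *: pi g v)).
    by apply/funext => g; rewrite !scale0r.
  rewrite (haar_linear ch (L := fun u : E => 0 *: u)) ?scale0r //; last exact: Step_hop.
  by move=> c x y; rewrite !scale0r scaler0 addr0.
have -> : lact (p :: a) f = fun x => p.1 * f (p.2^-1 * x)%g + lact a f x.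
  by apply/funext => x; rewrite /lact big_cons.
have Sp := Step_left p.2^-1%g Sf.
split; last by rewrite hop_comb // hop_left // IH /act big_cons.
apply: (Step_comp2 ch (F := fun a b => p.1 * a + b)) => //.
by rewrite mulr0 addr0.
Qed.

Definition trace_form (v : E) (m : dual E) : R[i]^o := m v.

Lemma trace_form_bilin : bilin trace_form.
Proof. by split=> [m|v] //; exact: dual_linear. Qed.

Lemma dual_ev_inj (m : dual E) : (forall x, dual_ev m x = 0) -> m = 0.
Proof. by move=> m0; apply/val_inj/funext. Qed.

(** The distribution character f |-> tr pi(f). *)
Definition chi (f : G -> R[i]) : R[i] := tensor_form (@dual_ev R[i] E) trace_form (hop f).

Lemma chiE f l : decomp (@dual_ev R[i] E) (hop f) l ->
  chi f = \sum_(p <- l) p.2 p.1.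
Proof.
move=> fl; rewrite /chi (tensor_formE (@dual_ev_bilin _ E) dual_ev_inj trace_form_bilin fl).
by [].
Qed.

Lemma chi_comb a f h : Step Kc f -> Step Kc h ->
  chi (fun x => a * f x + h x) = a * chi f + chi h.
Proof.
move=> Sf Sh; have [l fl] := hop_decomp Sf; have [l' hl] := hop_decomp Sh.
apply: (tensor_form_comb (@dual_ev_bilin _ E) dual_ev_inj trace_form_bilin fl hl).
by move=> x; apply: hop_comb.
Qed.

Hypothesis unimodular : forall g, modulus Kc R[i] g = 1.

Lemma hop_right f g v : Step Kc f -> hop (fun x => f (x * g^-1)%g) v = hop f (pi g v).
Proof.
move=> Sf; rewrite /hop -[LHS](haar_right ch unimodular g); last first.
  exact: (Step_hop v (Step_right ch _ Sf)).
by congr haar; apply/funext => x; rewrite mulgK repM.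
Qed.

Lemma hop_conj f k v : Step Kc f ->
  hop (fun x => f (k * x * k^-1)%g) v = pi k^-1%g (hop f (pi k v)).
Proof.
move=> Sf; rewrite -hop_right // -hop_left //; last exact: Step_right.
by congr hop; apply/funext => x; rewrite invgK.
Qed.

Lemma decomp_conj f k l : Step Kc f -> decomp (@dual_ev R[i] E) (hop f) l ->
  exists2 l', decomp (@dual_ev R[i] E) (hop (fun x => f (k * x * k^-1)%g)) l' &
    \sum_(p <- l') p.2 p.1 = \sum_(p <- l) p.2 p.1 :> R[i].
Proof.
move=> Sf fl.
have lin (m : dual E) : linear (fun v => m (pi k v)).
  by move=> a u v; rewrite linearP dual_linear.
exists [seq (pi k^-1%g p.1, mkdual (lin p.2)) | p <- l].
  move=> x; rewrite hop_conj // fl big_map linear_sum; apply: eq_bigr => p _ /=.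
  by rewrite linearZ.
by rewrite big_map; apply: eq_bigr => p _ /=; rewrite -repM mulgV rep1.
Qed.

Lemma chi_conj f k : Step Kc f -> chi (fun x => f (k * x * k^-1)%g) = chi f.
Proof.
move=> Sf; have [l fl] := hop_decomp Sf; have [l' fl' E'] := decomp_conj k Sf fl.
by rewrite (chiE fl) (chiE fl').
Qed.

Hypothesis irr : rep_irreducible pi.

Lemma chain_schur : schur_rep pi.
Proof.
have [v v0] := irr.1; have [m mv] := smooth_pi v.
apply: (schur irr (fixed_fin m)); first by exists v.
by move=> T _ cT w fw k Kk; rewrite -cT fw.
Qed.

Lemma rank_one_hop : exists f v (m : dual E), [/\ Step Kc f, v != 0,
  exists x, m x != 0 & forall x, hop f x = m x *: v].
Proof.
have [v v0] := irr.1; have [m mv] := smooth_pi v.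
have SK : Step Kc (ind1 m) by apply: Step_ind.
have [l fl] := hop_decomp SK.
have [|a [w [n [w0 n0 aE]]]] := rank_one_multiple irr chain_schur (@dual_ev_bilin _ E) fl.
  by exists v; rewrite hop_ind // scaler_eq0 negb_or v0 invr_eq0 chain_index_neq0.
exists (lact a (ind1 m)), w, n; split=> // [|x]; first by have [] := lact_hop a v SK.
by have [_ ->] := lact_hop a x SK.
Qed.

(** * Construction of the invariant form *)

Variable t : G -> G.
Hypotheses (tM : forall x y, t (x * y)%g = (t y * t x)%g) (tK : involutive t).
Hypothesis tKc : forall m x, Kc m x -> Kc m (t x).

Record invariant_form (b : E -> E -> R[i]^o) (eps : R[i]) : Prop := InvariantForm {
  form_bilin : bilin b;
  form_inv : forall g u v, b (pi g u) v = b u (pi (t g) v);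
  form_sym : forall u v, b u v = eps * (b v u : R[i]);
  form_nondeg : forall u, (forall v, b u v = 0) -> u = 0
}.

(** The radical of an invariant form is a subrepresentation, so nonzero means non-degenerate. If
    b(u, v) + b(v, u) vanishes identically, [eps] = -1; otherwise this sum is a nonzero symmetric
    form, invariant because [t] is an involution. *)
Lemma nondegenerate_form (b : E -> E -> R[i]^o) : bilin b ->
  (forall g u v, b (pi g u) v = b u (pi (t g) v)) -> (exists u v, b u v != 0) ->
  exists b' eps, invariant_form b' eps.
Proof.
move=> bb binv [u0 [v0 b0]].
have nondeg (c : E -> E -> R[i]^o) : bilin c ->
    (forall g u v, c (pi g u) v = c u (pi (t g) v)) -> (exists u v, c u v != 0) ->
    forall u, (forall v, c u v = 0) -> u = 0.
  move=> bc cinv [u1 [v1 c1]] u cu; apply: contrapT => /eqP nu.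
  suff : [set u | forall v, c u v = 0] u1 by move/(_ v1)/eqP; apply/negP.
  apply: (irreducible_set irr (S := [set u | forall v, c u v = 0])) => [a x y x0 y0 v|g x x0 v|]; last by exists u.
    by rewrite (bilinl bc) x0 y0 scaler0 addr0.
  by rewrite cinv x0.
have binv' g u v : b u (pi g v) = b (pi (t g) u) v by rewrite binv tK.
have [alt|/existsNP[u /existsNP[v /eqP nalt]]] :=
  pselect (forall u v, (b u v : R[i]) + b v u = 0).
  exists b, (-1); split=> // [u v|].
    by rewrite mulN1r; apply/eqP; rewrite -addr_eq0; apply/eqP.
  by apply: nondeg => //; exists u0, v0.
pose c u v : R[i]^o := b u v + b v u.
have bc : bilin c.
  split=> [x|x] a y z; rewrite /c (bilinl bb) (bilinr bb) scalerDr addrACA //.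
have cinv g x y : c (pi g x) y = c x (pi (t g) y).
  by rewrite /c binv [b y _]binv'.
exists c, 1; split=> //; first by move=> x y; rewrite mul1r /c addrC.
by apply: nondeg => //; exists u, v.
Qed.

Hypothesis chi_anti : forall f, Step Kc f -> chi (f \o t) = chi f.

(** By [chi_anti], tr(pi(y) pi(f o t)) = tr(pi(f) pi(t y)) = 0 for all y, and the trace pairing with
    the group algebra is non-degenerate. *)
Lemma hop_anti_eq0 f : Step Kc f -> (forall v, hop f v = 0) ->
  forall v, hop (f \o t) v = 0.
Proof.
move=> Sf f0 v; have Sft := Step_anti ch tM tK tKc Sf.
have [l fl] := hop_decomp Sft; rewrite fl.
apply: (tensor_eq0_act irr chain_schur (@dual_ev_bilin _ E) dual_ev_inj
  (bilin_ev_op (@dual_ev_bilin _ E) v)) => a.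
have tr y : \sum_(p <- l) p.2 (pi y p.1) = 0.
  (* pi(f') = pi(f) pi(t y), while f' o t is the left translate of f o t by [y]. *)
  pose f' x := f (x * (t y)^-1)%g.
  have Sf' : Step Kc f' by apply: Step_right.
  have : chi f' = 0.
    rewrite (@chiE f' [::]) ?big_nil // => x.
    by rewrite big_nil hop_right ?f0.
  apply: etrans; rewrite -chi_anti //.
  rewrite (@chiE _ [seq (pi y p.1, p.2) | p <- l]) ?big_map // => x.
  have -> : f' \o t = fun x => (f \o t) (y^-1 * x)%g.
    by apply/funext => z; rewrite /f' /= tM (antiV tM).
  by rewrite hop_left //; apply: (decomp_comp (linearP (pi y)) fl).
rewrite /act /dual_ev; under eq_bigr do rewrite (linear_fun_sumZ (@dual_linear _ _ _)).
rewrite exchange_big big1 //= => p _.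
by rewrite -scaler_sumr tr scaler0.
Qed.

Lemma lact_cat a b f x : lact (a ++ b) f x = lact a f x + lact b f x.
Proof. by rewrite /lact big_cat. Qed.

Lemma lact_scale c a f x : lact (act_scale c a) f x = c * lact a f x.
Proof. by rewrite /lact big_map mulr_sumr; apply: eq_bigr => p _; rewrite mulrA. Qed.

Lemma lact_translate g a f x : lact (act_mul [:: (1, g)] a) f x = lact a f (g^-1 * x)%g.
Proof.
rewrite /lact /act_mul /= cats0 big_map; apply: eq_bigr => p _ /=.
by rewrite mul1r invgM mulgA.
Qed.

(* For a rank one operator pi(f0) = m (x) v0, the operator pi((a f0) o t) depends
   only on a v0, so composing it with a linear form gives a bilinear form. *)
Theorem invariant_form_exists : exists b eps, invariant_form b eps.
Proof.
have [f0 [v0 [m [Sf0 nv0 [x0 mx0] f0E]]]] := rank_one_hop.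
have Slact a : Step Kc (lact a f0) by have [] := lact_hop a 0 Sf0.
have Slactt a : Step Kc (lact a f0 \o t) by apply: Step_anti.
have lactE a x : hop (lact a f0) x = m x *: act pi a v0.
  by have [_ ->] := lact_hop a x Sf0; rewrite f0E (linear_funZ (@act_linear _ _ _ _ _)).
have uniq a a' w : act pi a v0 = act pi a' v0 ->
    hop (lact a f0 \o t) w = hop (lact a' f0 \o t) w.
  move=> aa'; pose f x := -1 * lact a' f0 x + lact a f0 x.
  have Sf : Step Kc f.
    by apply: (Step_comp2 ch (F := fun a b => -1 * a + b)); rewrite // mulr0 addr0.
  have fz v : hop f v = 0 by rewrite hop_comb // !lactE aa' scaleN1r addNr.
  have := hop_anti_eq0 Sf fz w.
  rewrite -[X in X = _]/(hop (fun x => -1 * (lact a' f0 \o t) x + (lact a f0 \o t) x) w).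
  by rewrite hop_comb // scaleN1r addrC => /eqP; rewrite subr_eq0 => /eqP.
have /choice[k kP] := fun v => act_transitive irr v nv0.
pose Y v := hop (lact (k v) f0 \o t).
have YE a w : Y (act pi a v0) w = hop (lact a f0 \o t) w by apply: uniq; rewrite kP.
have Yl w : linear (Y ^~ w).
  move=> c u v; rewrite /= -{1}(kP u) -{1}(kP v) -actZ -act_cat YE.
  rewrite -hop_comb //; congr hop; apply/funext => x /=.
  by rewrite lact_cat lact_scale.
have Yr v : linear (Y v) by apply: hop_linear.
have Yg g v w : Y (pi g v) w = Y v (pi (t g) w).
  rewrite -{1}(kP v) -act1 -actM YE /Y -hop_right //; congr hop; apply/funext => x /=.
  by rewrite lact_translate tM (antiV tM) tK.
(* If pi(f0 o t) vanished, a second application of [hop_anti_eq0] would make pi(f0) vanish. *)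
have [w0 Yw0] : exists w, Y v0 w != 0.
  apply: contrapT => nY; have : hop f0 x0 = 0.
    have -> : f0 = (f0 \o t) \o t by apply/funext => x; rewrite /= tK.
    apply: hop_anti_eq0 => [|w]; first exact: Step_anti.
    apply: contrapT => /eqP fw; apply: nY; exists w.
    rewrite -[v0](rep1 pi) -act1 YE; apply: contra_neq fw => <-.
    congr hop; apply/funext => x; rewrite /= /lact big_seq1 /= invg1 mul1g mul1r //.
  by rewrite f0E => /eqP; rewrite scaler_eq0 (negbTE mx0) (negbTE nv0).
(* The linear form composed with [Y] is a translate of [m]: one of them is nonzero at [Y v0 w0],
   whose translates span. *)
have [y my] : exists y, m (pi y (Y v0 w0)) != 0.
  apply: contrapT => nm; have [a aE] := act_transitive irr x0 Yw0.
  case/negP: mx0; rewrite -aE /act (linear_fun_sumZ (@dual_linear _ _ m)).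
  rewrite big1 // => p _; suff -> : m (pi p.2 (Y v0 w0)) = 0 by rewrite scaler0.
  by apply: contrapT => /eqP mp; apply: nm; exists p.2.
apply: (@nondegenerate_form (fun v w => m (pi y (Y v w)))).
- by split=> [w|v] c x z /=; rewrite ?Yl ?Yr linearP dual_linear.
- by move=> g u v; rewrite Yg.
- by exists v0, w0.
Qed.

End HeckeOperators.

(** * General linear groups over a local field *)

(* Block elimination writes A as a product of unipotents and of diag(a, 1),
   diag(1, D). A unipotent is conjugate to its square, diag(a, 1) is symmetric,
   and diag(1, D) is handled by induction. *)
Lemma trivial_unit_character (F : fieldType) (K : numDomainType) : (2%:R : F) != 0 ->
  forall n (x : 'M[F]_n -> K),
  (forall A B, A \in unitmx -> B \in unitmx -> x (A *m B) = x A * x B) ->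
  (forall A, A \in unitmx -> x A^T * x A = 1) ->
  (forall A, A \in unitmx -> 0 <= x A) ->
  forall A, A \in unitmx -> x A = 1.
Proof.
move=> two_neq0; elim=> [|n IHn] x xM xT x_ge0 A uA.
  have := xT A uA; rewrite (flatmx0 A) trmx0 => /eqP.
  by rewrite -expr2 sqrp_eq1 ?x_ge0 -?(flatmx0 A) // => /eqP.
have sym B : B \in unitmx -> B^T = B -> x B = 1.
  move=> uB tB; have /eqP := xT B uB; rewrite tB -expr2 sqrp_eq1 ?x_ge0 //.
  by move/eqP.
have x_neq0 B : B \in unitmx -> x B != 0.
  by move=> /xT xB; apply/eqP => x0; move/eqP: xB; rewrite x0 mulr0 eq_sym oner_eq0.
have ublock m1 m2 (a : 'M[F]_m1) (b : 'M[F]_(m1, m2)) c (d : 'M[F]_m2) :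
    a \in unitmx -> d \in unitmx -> b = 0 \/ c = 0 -> block_mx a b c d \in unitmx.
  by rewrite !unitmxE => ua ud [] ->; rewrite ?det_lblock ?det_ublock unitrM ua ud.
pose low (c : 'M[F]_(n, 1)) : 'M[F]_(1 + n) := block_mx 1%:M 0 c 1%:M.
have ulow c : low c \in unitmx by apply: ublock; rewrite ?unitmx1 //; left.
have xlow c : x (low c) = 1.
  pose d : 'M[F]_(1 + n) := block_mx (2%:R)%:M 0 0 1%:M.
  have ud : d \in unitmx.
    by apply: ublock; rewrite ?unitmx1 //; [rewrite unitmxE det_scalar1 unitfE|left].
  have E1 : d *m (low c *m low c) = low c *m d.
    rewrite !mulmx_block !(mulmx1, mul1mx, mulmx0, mul0mx, addr0, add0r).
    by rewrite mul_mx_scalar scaler_nat mulr2n.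
  have := congr1 x E1; rewrite !xM ?unitmx_mul ?ud ?ulow // [RHS]mulrC.
  move/(mulfI (x_neq0 _ ud)); rewrite -[RHS]mulr1.
  exact/mulfI/x_neq0.
have xup c : x (low c)^T = 1 by have := xT _ (ulow c); rewrite xlow mulr1.
have uup c : (low c)^T \in unitmx by rewrite unitmx_tr.
have upE c : (low c)^T = block_mx 1%:M c^T 0 1%:M.
  by rewrite tr_block_mx !trmx1 trmx0.
(* Secures an invertible pivot: if the corner entry is 0, the first column has a nonzero entry [i]
   below it, and a unipotent adds that row to the first without changing [x]. *)
have [B [uB <-] ua] : exists2 B : 'M[F]_(1 + n), B \in unitmx /\ x B = x A & ulsubmx B \in unitmx.
  pose A' : 'M[F]_(1 + n) := A.
  have AE : A' = block_mx (ulsubmx A') (ursubmx A') (dlsubmx A') (drsubmx A').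
    by rewrite submxK.
  have [ua'|na] := boolP (ulsubmx A' \in unitmx); first by exists A'.
  have a0 : ulsubmx A' = 0.
    apply/eqP; apply: contraNT na => a0; rewrite unitmxE (mx11_scalar (ulsubmx A')).
    rewrite det_scalar1 unitfE; apply: contraNneq a0 => a0.
    by rewrite (mx11_scalar (ulsubmx A')) a0 raddf0.
  have [c0|[i ci]] : dlsubmx A' = 0 \/ exists i, dlsubmx A' i 0 != 0.
  - have [/existsP|/existsPn nex] := boolP [exists i, dlsubmx A' i 0 != 0]; first by right.
    by left; apply/matrixP => i j; rewrite ord1 [RHS]mxE; have := nex i; rewrite negbK => /eqP.
  - have : A' *m col_mx (1%:M : 'M[F]_1) (0 : 'M[F]_(n, 1)) = 0.
      by rewrite AE mul_block_col a0 c0 !mulmx0 !mul0mx !addr0 col_mx0.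
    move=> /(congr1 (mulmx (invmx A'))); rewrite mulKmx // mulmx0.
    move=> /(congr1 usubmx); rewrite col_mxKu => /matrixP/(_ 0 0)/eqP.
    by rewrite !mxE oner_eq0.
  exists ((low (delta_mx i 0))^T *m A').
    by split; [rewrite unitmx_mul uup|rewrite xM // xup mul1r].
  rewrite upE -[A']submxK mulmx_block block_mxKul a0 mulmx0 add0r.
  rewrite trmx_delta unitmxE [X in \det X]mx11_scalar det_scalar1 unitfE.
  by rewrite -rowE mxE.
set a := ulsubmx B in ua *; pose b := ursubmx B; pose c := dlsubmx B; pose d := drsubmx B.
pose s := d - c *m invmx a *m b.
have BE : B = low (c *m invmx a) *m block_mx a 0 0 s *m (low (invmx a *m b)^T)^T.
  rewrite upE trmxK !mulmx_block !(mulmx1, mul1mx, mulmx0, mul0mx, addr0, add0r).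
  rewrite mulKVmx // mulmxKV // /s !mulmxA addrC subrK.
  by rewrite -[LHS]submxK.
have us : s \in unitmx.
  move: uB; rewrite BE !unitmx_mul ulow uup /= andbT.
  by rewrite !unitmxE det_ublock unitrM => /andP[].
have uas : block_mx a 0 0 s \in unitmx by apply: ublock => //; left.
rewrite BE !xM ?unitmx_mul ?ulow ?uup ?uas // xlow xup mulr1 mul1r.
have -> : block_mx a 0 0 s = block_mx a 0 0 1%:M *m block_mx 1%:M 0 0 s.
  by rewrite mulmx_block !(mulmx1, mul1mx, mulmx0, mul0mx, addr0, add0r).
have u1 X : X \in unitmx -> block_mx (1%:M : 'M[F]_1) 0 0 X \in unitmx.
  by move=> uX; apply: ublock; rewrite ?unitmx1 //; left.
have ua1 : block_mx a 0 0 (1%:M : 'M[F]_n) \in unitmx.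
  by apply: ublock; rewrite ?unitmx1 //; left.
rewrite xM ?u1 // sym ?mul1r //; last first.
  have tb : (block_mx a 0 0 1%:M : 'M[F]_(1 + n))^T = block_mx a 0 0 1%:M.
    by rewrite tr_block_mx !trmx0 trmx1 [a]mx11_scalar tr_scalar_mx.
  exact: tb.
apply: (IHn (fun X => x (block_mx (1%:M : 'M[F]_1) 0 0 X))) => // [X Y uX uY|X uX|X uX].
- rewrite -xM ?u1 //.
  have mb : block_mx (1%:M : 'M[F]_1) 0 0 X *m block_mx (1%:M : 'M[F]_1) 0 0 Y =
      block_mx 1%:M 0 0 (X *m Y).
    by rewrite mulmx_block !(mulmx1, mul1mx, mulmx0, mul0mx, addr0, add0r).
  by rewrite -mb.
- rewrite -[RHS](xT _ (u1 _ X uX)); congr (x _ * _).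
  have tb : (block_mx 1%:M 0 0 X : 'M[F]_(1 + n))^T = block_mx 1%:M 0 0 X^T.
    by rewrite tr_block_mx !trmx0 trmx1.
  exact/esym/tb.
- by apply/x_ge0/u1.
Qed.

(** * Matrices over an ultrametric field *)

Section NonarchimedeanNorm.
Variables (R : realType) (F : fieldType) (nu : F -> R).
Hypothesis nuP : nonarchimedean_abs nu.

Lemma nu0 : nu 0 = 0. Proof. by apply/(nonarch_abs_eq0 nuP). Qed.

Lemma nu_gt0 x : x != 0 -> 0 < nu x.
Proof.
move=> x0; rewrite lt0r (nonarch_abs_ge0 nuP) andbT; apply/eqP.
by move/(nonarch_abs_eq0 nuP)/eqP; apply/negP.
Qed.

Lemma nu1 : nu 1 = 1.
Proof.
have /lt0r_neq0 n1 := nu_gt0 (oner_neq0 F).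
by apply: (mulfI n1); rewrite -(nonarch_absM nuP) !mulr1.
Qed.

Lemma nuN x : nu (- x) = nu x.
Proof.
have /eqP : nu (-1) ^+ 2 = 1 by rewrite expr2 -(nonarch_absM nuP) mulrNN mulr1 nu1.
rewrite sqrp_eq1 ?(nonarch_abs_ge0 nuP) // => /eqP n1.
by rewrite -mulN1r (nonarch_absM nuP) n1 mul1r.
Qed.

Lemma nuV x : x != 0 -> nu x^-1 = (nu x)^-1.
Proof.
move=> x0; have /lt0r_neq0 n0 := nu_gt0 x0.
by apply: (mulfI n0); rewrite -(nonarch_absM nuP) !mulfV // nu1.
Qed.

Lemma nuD_le r x y : nu x <= r -> nu y <= r -> nu (x + y) <= r.
Proof.
by move=> xr yr; apply: le_trans (nonarch_absD nuP x y) _; rewrite ge_max xr.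
Qed.

Lemma nu_sum_le (I : Type) (s : seq I) (f : I -> F) r : 0 <= r ->
  (forall i, nu (f i) <= r) -> nu (\sum_(i <- s) f i) <= r.
Proof.
move=> r0 fr; elim: s => [|i s IHs]; first by rewrite big_nil nu0.
by rewrite big_cons nuD_le.
Qed.

Definition mxle r m n (X : 'M[F]_(m, n)) := forall i j, nu (X i j) <= r.

Lemma mxle_trans r r' m n (X : 'M[F]_(m, n)) : r <= r' -> mxle r X -> mxle r' X.
Proof. by move=> rr' Xr i j; apply: le_trans (Xr i j) rr'. Qed.

Lemma mxleD r m n (X Y : 'M[F]_(m, n)) : mxle r X -> mxle r Y -> mxle r (X + Y).
Proof. by move=> Xr Yr i j; rewrite mxE; apply: nuD_le. Qed.

Lemma mxleN r m n (X : 'M[F]_(m, n)) : mxle r X -> mxle r (- X).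
Proof. by move=> Xr i j; rewrite mxE nuN. Qed.

Lemma mxleM r s m n p (X : 'M[F]_(m, n)) (Y : 'M[F]_(n, p)) : 0 <= r -> 0 <= s ->
  mxle r X -> mxle s Y -> mxle (r * s) (X *m Y).
Proof.
move=> r0 s0 Xr Ys i j; rewrite mxE; apply: nu_sum_le => [|k]; first exact: mulr_ge0.
by rewrite (nonarch_absM nuP) ler_pM // (nonarch_abs_ge0 nuP).
Qed.

Lemma mxle1 n : mxle 1 (1%:M : 'M[F]_n).
Proof. by move=> i j; rewrite mxE; case: eqP; rewrite ?nu1 ?nu0. Qed.

Lemma mxle_bound m n (X : 'M[F]_(m, n)) : exists2 r, 0 < r & mxle r X.
Proof.
exists (1 + \sum_i \sum_j nu (X i j)).
  by rewrite ltr_pwDl // !sumr_ge0 // => i _; rewrite sumr_ge0 // => j _; apply: (nonarch_abs_ge0 nuP).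
have nn k l : 0 <= nu (X k l) by apply: (nonarch_abs_ge0 nuP).
move=> i j; apply: ler_wpDl => //; rewrite (bigD1 i) //= (bigD1 j) //= -addrA lerDl.
by rewrite addr_ge0 // !sumr_ge0 // => k _; rewrite sumr_ge0.
Qed.

Lemma nu_contracting : exists2 x, x != 0 & nu x < 1.
Proof.
have [x x0 nx] := nonarch_abs_nontrivial nuP.
have [ltx|gtx|eqx] := ltgtP (nu x) 1; last by rewrite eqx eqxx in nx.
  by exists x.
by exists x^-1; rewrite ?invr_eq0 // nuV // invf_lt1 // nu_gt0.
Qed.

(** If the largest absolute value s of an entry of [X] exceeded 1, then s <= max(1, r s) < s. This
    takes the place of a Neumann series. *)
Lemma mxle_contract r m n (Y : 'M[F]_m) (X Z : 'M[F]_(m, n)) : 0 <= r -> r < 1 ->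
  mxle r Y -> X = Z + Y *m X -> mxle 1 Z -> mxle 1 X.
Proof.
move=> r0 r1 Yr XE Z1 i j.
case: (@Order.TotalTheory.arg_maxP _ R _ (i, j) xpredT (fun p => nu (X p.1 p.2)) isT).
move=> [k l] _ /= kmax; have kl := kmax (i, j) isT; apply: le_trans kl _.
rewrite leNgt; apply/negP => lt1.
have Xs : mxle (nu (X k l)) X by move=> a b; apply: (kmax (a, b)).
have := mxleM r0 (nonarch_abs_ge0 nuP (X k l)) Yr Xs k l.
have s0 : 0 < nu (X k l) by apply: lt_trans lt1.
have := nonarch_absD nuP (Z k l) ((Y *m X) k l).
rewrite -[Z k l + _](_ : X k l = _); last by rewrite {1}XE mxE.
rewrite le_max => /orP[/le_trans/(_ (Z1 k l))|le1 le2]; first by rewrite leNgt lt1.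
have := le_trans le1 le2; rewrite ler_pMl // leNgt.
by rewrite r1.
Qed.

Lemma near1_unitmx r n (Y : 'M[F]_n) : 0 <= r -> r < 1 -> mxle r Y -> 1%:M + Y \in unitmx.
Proof.
move=> r0 r1 Yr; rewrite unitmxE unitfE; apply/negP => /det0P[v v0 vY].
have vE : v^T = 0 + (- Y^T) *m v^T.
  rewrite mulNmx -trmx_mul add0r; apply/eqP; rewrite -addr_eq0 -linearD /=.
  by rewrite -{1}(mulmx1 v) -mulmxDr vY trmx0.
have Yr' : mxle r (- Y^T) by apply: mxleN => i j; rewrite mxE.
(* Applied to all multiples of v, the contraction bound forces v = 0. *)
have small c : mxle 1 (c *: v^T).
  apply: (mxle_contract r0 r1 Yr' (Z := 0)); last by move=> i j; rewrite mxE nu0.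
  by rewrite {1}vE -scalemxAr scalerDr scaler0.
have [/existsP[j vj]|/existsPn nv] := boolP [exists j, v 0 j != 0]; last first.
  by case/eqP: v0; apply/rowP => j; rewrite mxE; have := nv j; rewrite negbK => /eqP.
have [x x0 nx] := nu_contracting.
(* The multiple is chosen to make entry [j] equal to x^-1, of absolute value greater than 1. *)
have := small ((x * v 0 j)^-1) j 0; rewrite !mxE invfM divfK // nuV // leNgt.
by rewrite invf_gt1 ?nu_gt0 // nx.
Qed.

End NonarchimedeanNorm.

Section Balls.
Variables (R : realType) (F : preTopologicalFieldType) (nu : F -> R).
Hypothesis nuP : nonarchimedean_abs nu.
Hypothesis nbhsF : forall x : F,
  nbhs x = filter_from [set r : R | 0 < r] (fun r => [set y | nu (y - x) < r]).

Lemma ball_closed r : closed [set x : F | nu x <= r].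
Proof.
move=> x cx; rewrite /= leNgt; apply/negP => lt.
have n0 : 0 < nu x.
  have [y [/= yr _]] := cx setT filterT.
  exact: le_lt_trans (le_trans (nonarch_abs_ge0 nuP y) yr) lt.
have [|y [/= yr yx]] := cx [set y | nu (y - x) < nu x].
  by rewrite nbhsF; exists (nu x).
have := nonarch_absD nuP y (x - y); rewrite addrC subrK -(nuN nuP (x - y)) opprB.
by rewrite leNgt gt_max yx andbT (le_lt_trans yr lt).
Qed.

Lemma local_field_radii : locally_compact [set: F] ->
  exists rho : nat -> R, [/\ forall m, 0 < rho m, forall m, rho m < 1,
    forall m m', (m <= m')%N -> rho m' <= rho m,
    forall r, 0 < r -> exists m, rho m < r & compact [set x | nu x <= rho 0]].
Proof.
move=> lcF; have [x x0 nx] := nu_contracting nuP; have n0 := nu_gt0 nuP x0.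
have powlt r : 0 < r -> exists n, nu x ^+ n < r.
  move=> r0; have : `|nu x| < 1 by rewrite gtr0_norm.
  move=> /cvg_expr/cvgrPdist_lt/(_ r r0)[n _ /(_ n (leqnn n))].
  by rewrite sub0r normrN gtr0_norm ?exprn_gt0 //; exists n.
have [U U0 [cU _]] := lcF 0 I.
have {}U0 : nbhs (0 : F) [set y | [set: F] y -> U y] by exact: U0.
have : nbhs (0 : F) U by apply: filterS U0 => y; apply.
rewrite nbhsF => -[r r0 rU]; have [n nr] := powlt r r0.
have mono m m' : (m <= m')%N -> nu x ^+ m' <= nu x ^+ m.
  by move=> mm'; apply: ler_wiXn2l => //; apply: ltW.
(* [n] puts the ball of radius [rho 0] inside the compact neighbourhood; the successor keeps [rho 0]
   below 1 even when [n] is 0. *)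
exists (fun m => nu x ^+ (m + n.+1)); split=> [m|m|m m' mm'|d d0|].
- exact: exprn_gt0.
- by rewrite exprn_ilt1 ?ltW // addnS.
- by apply: mono; rewrite leq_add2r.
- have [m md] := powlt d d0; exists m; apply: le_lt_trans md; apply: mono.
  exact: leq_addr.
apply: (subclosed_compact (@ball_closed _) cU) => y /= yr; apply: rU => /=.
by rewrite subr0 (le_lt_trans yr) // (le_lt_trans _ nr) // mono.
Qed.

End Balls.

(** * Principal congruence subgroups *)

Section GeneralLinearChain.
Variables (R : realType) (F : preTopologicalFieldType) (nu : F -> R).
Hypothesis nuP : nonarchimedean_abs nu.
Hypothesis nbhsF : forall x : F,
  nbhs x = filter_from [set r : R | 0 < r] (fun r => [set y | nu (y - x) < r]).
Variable rho : nat -> R.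
Hypotheses (rho_gt0 : forall m, 0 < rho m) (rho_lt1 : forall m, rho m < 1).
Hypothesis rho_mono : forall m m', (m <= m')%N -> rho m' <= rho m.
Hypothesis rho_lim : forall r, 0 < r -> exists m, rho m < r.
Hypothesis ball_compact : compact [set x | nu x <= rho 0].
Variables (E : vectType F) (e : (\dim {:E}).-tuple E) (eP : basis_of {:E} e).

Local Notation N := (\dim {:E}).
Implicit Types g h x y k : GL E.

Definition bmx (g : GL E) : 'M[F]_N := passmx.mxof e e g.

(** Taken in the basis [e] that defines transposition, so that [GL_tr eP] preserves it; radii below
    1 make it a group. *)
Definition congr_subgroup (m : nat) : set (GL E) :=
  [set g | mxle nu (rho m) (bmx g - 1%:M)].

Let rho_ge0 m : 0 <= rho m := ltW (rho_gt0 m).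

Lemma bmxM g h : bmx (g * h)%g = bmx h *m bmx g.
Proof. exact: passmx.mxof_comp. Qed.

Lemma bmx1 : bmx 1%g = 1%:M.
Proof. exact: passmx.mxof1 (basis_free eP). Qed.

Lemma bmx_inj : injective bmx.
Proof. by move=> g h /(can_inj (passmx.mxofK eP eP)) gh; apply: val_inj. Qed.

Lemma bmxV g : bmx g *m bmx g^-1%g = 1%:M.
Proof. by rewrite -bmxM mulVg bmx1. Qed.

Lemma bmx_unit g : bmx g \in unitmx.
Proof. by have [] := mulmx1_unit (bmxV g). Qed.

Lemma bmx_surj X : X \in unitmx -> exists g, bmx g = X.
Proof.
move=> uX; have ker : lker (passmx.hommx e e X) == 0%VS.
  have c1 : (passmx.hommx e e (invmx X) \o passmx.hommx e e X)%VF = \1%VF.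
    rewrite -passmx.hommx_mul // mulmxV // -(passmx.mxof1 (basis_free eP)).
    by rewrite passmx.mxofK.
  apply/lker0P => u v /(congr1 (passmx.hommx e e (invmx X))).
  by rewrite -!comp_lfunE c1 !id_lfunE.
by exists (MkGL ker); apply: passmx.hommxK.
Qed.

(** g^-1 = 1 - (g - 1) g^-1, to which the contraction bound applies. *)
Lemma congr_subgroup_inv_le1 m g : congr_subgroup m g -> mxle nu 1 (bmx g^-1%g).
Proof.
move=> Kg; apply: (mxle_contract nuP (rho_ge0 m) (rho_lt1 m) (mxleN nuP Kg)).
  2: exact: mxle1.
by rewrite mulNmx mulmxBl bmxV mul1mx opprB addrC subrK.
Qed.

Lemma congr_subgroupM m g h :
  congr_subgroup m g -> congr_subgroup m h -> congr_subgroup m (g * h)%g.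
Proof.
move=> Kg Kh; rewrite /congr_subgroup /= bmxM.
have -> : bmx h *m bmx g - 1%:M =
    (bmx h - 1%:M) *m (bmx g - 1%:M) + ((bmx h - 1%:M) + (bmx g - 1%:M)).
  rewrite mulmxBl mul1mx mulmxBr mulmx1.
  by rewrite [X in _ = _ + X]addrC addrA subrK addrA subrK.
apply: mxleD => //; last exact: mxleD.
apply: (@mxle_trans _ _ _ (rho m * rho m)); first by rewrite ger_pMl // ltW.
exact: mxleM.
Qed.

Lemma congr_subgroupV m g : congr_subgroup m g -> congr_subgroup m g^-1%g.
Proof.
move=> Kg; have Z1 := congr_subgroup_inv_le1 Kg; rewrite /congr_subgroup /=.
have -> : bmx g^-1%g - 1%:M = - ((bmx g - 1%:M) *m bmx g^-1%g).
  by rewrite mulmxBl bmxV mul1mx opprB.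
by apply: mxleN => //; rewrite -[rho m]mulr1; apply: mxleM.
Qed.

Lemma congr_conj_le g k m (a b : R) : 0 < a -> 0 < b ->
  mxle nu a (bmx g) -> mxle nu b (bmx g^-1%g) -> congr_subgroup m k ->
  mxle nu (b * rho m * a) (bmx (g * k * g^-1)%g - 1%:M).
Proof.
move=> a0 b0 ga gb Kk; rewrite !bmxM.
have -> : bmx g^-1%g *m (bmx k *m bmx g) - 1%:M =
    bmx g^-1%g *m (bmx k - 1%:M) *m bmx g.
  rewrite mulmxBr mulmx1 mulmxBl mulmxA; congr (_ - _).
  by rewrite -bmxM mulgV bmx1.
by apply: mxleM => //; rewrite ?mulr_ge0 // ?ltW //; apply: mxleM => //; apply: ltW.
Qed.

Lemma congr_subgroup_conj g m : exists m', forall k,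
  congr_subgroup m' k -> congr_subgroup m (g * k * g^-1)%g.
Proof.
have [a a0 ga] := mxle_bound nuP (bmx g); have [b b0 gb] := mxle_bound nuP (bmx g^-1%g).
have [m' m'P] : exists m', rho m' < rho m / (a * b).
  by apply: rho_lim; rewrite divr_gt0 // mulr_gt0.
exists m' => k Kk; apply: mxle_trans (congr_conj_le a0 b0 ga gb Kk).
move: m'P; rewrite ltr_pdivlMr ?mulr_gt0 // => /ltW; apply: le_trans.
by rewrite [b * _]mulrC -mulrA [b * a]mulrC.
Qed.

Lemma nbhs_GL_mx (x : GL E) (A : set (GL E)) : nbhs x A <->
  exists2 r : R, 0 < r &
    forall y, (forall i j, nu (GL_mx y i j - GL_mx x i j) < r) -> A y.
Proof.
split=> [|[r r0 rA]].
  rewrite nbhsE => -[U [[V oV <-] Vx] UA].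
  have [P nP PV] : nbhs (GL_mx x) V by apply: open_nbhs_nbhs; split.
  have /choice[s sP] : forall p : 'I_N * 'I_N, exists r : R, 0 < r /\
      forall z, nu (z - GL_mx x p.1 p.2) < r -> P p.1 p.2 z.
    move=> [i j]; have := nP i j; rewrite nbhsF => -[r r0 rP].
    by exists r; split.
  exists (\big[Num.min/1]_p s p).
    elim/big_ind: _ => // [a b a0 b0|p _]; first by rewrite lt_min a0.
    by have [] := sP p.
  move=> y yP; apply: UA; apply: PV => i j; have [_] := sP (i, j); apply.
  apply: lt_le_trans (yP i j) _.
  by apply: (@bigmin_le_cond _ _ _ 1 (i, j) xpredT s).
have nV : nbhs (GL_mx x) [set X | forall i j, nu (X i j - GL_mx x i j) < r].
  exists (fun i j => [set z | nu (z - GL_mx x i j) < r]) => [i j|X XP i j]; last exact: XP.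
  by rewrite nbhsF; exists r.
have : nbhs x (@GL_mx F E @^-1` [set X | forall i j, nu (X i j - GL_mx x i j) < r]).
  exact: (initial_continuous nV).
by apply: filterS => y; apply: rA.
Qed.

(** Base change between [vbasis], which defines the topology, and [e]. *)
Lemma GL_mx_bmx : exists C D : 'M[F]_N, C *m D = 1%:M /\
  forall g, GL_mx g = C *m bmx g *m D.
Proof.
pose b := vbasis {:E}; have bP : basis_of {:E} b := vbasisP _.
exists (passmx.mxof b e \1%VF), (passmx.mxof e b \1%VF); split=> [|g].
  by rewrite -passmx.mxof_comp // comp_lfun1l passmx.mxof1 // (basis_free bP).
rewrite /bmx -passmx.mxof_comp // -passmx.mxof_comp //.
by rewrite comp_lfun1l comp_lfun1r.
Qed.

(** With the row convention, x k - x becomes (k - 1) x. The two kinds of neighbourhoods are compared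
    through bounds on [C], [D], x and x^-1. *)
Lemma nbhs_congr (x : GL E) (A : set (GL E)) : nbhs x A <->
  exists m, forall k, congr_subgroup m k -> A (x * k)%g.
Proof.
have [C [D [CD GE]]] := GL_mx_bmx.
have [c c0 Cc] := mxle_bound nuP C; have [d d0 Dd] := mxle_bound nuP D.
have [a a0 xa] := mxle_bound nuP (bmx x).
split=> [/nbhs_GL_mx[r r0 rA]|[m mA]].
  have [m mP] : exists m, rho m < r / (c * a * d).
    by apply: rho_lim; rewrite divr_gt0 // !mulr_gt0.
  exists m => k Kk; apply: rA => i j.
  have -> : GL_mx (x * k)%g i j - GL_mx x i j =
      (C *m ((bmx k - 1%:M) *m bmx x) *m D) i j.
    by rewrite mulmxBl mul1mx mulmxBr mulmxBl -bmxM -!GE !mxE.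
  apply: le_lt_trans (mxleM nuP _ _ (mxleM nuP _ _ Cc (mxleM nuP _ _ Kk xa)) Dd i j) _;
    rewrite ?mulr_ge0 // ?ltW //.
  move: mP; rewrite ltr_pdivlMr ?mulr_gt0 //; apply: le_lt_trans.
  by rewrite mulrCA !mulrA.
have [b b0 xb] := mxle_bound nuP (bmx x^-1%g).
have DC : D *m C = 1%:M by apply: mulmx1C.
apply/nbhs_GL_mx; exists (rho m / (d * c * b)); first by rewrite divr_gt0 // !mulr_gt0.
move=> y yP; rewrite -[y](mulVKg x); apply: mA.
rewrite /congr_subgroup /= bmxM.
have -> : bmx y *m bmx x^-1%g - 1%:M = (D *m (GL_mx y - GL_mx x) *m C) *m bmx x^-1%g.
  rewrite !GE -mulmxBl -mulmxBr !mulmxA DC mul1mx -[_ *m D *m C]mulmxA DC mulmx1.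
  by rewrite mulmxBl bmxV.
have yx : mxle nu (rho m / (d * c * b)) (GL_mx y - GL_mx x).
  by move=> i j; have := ltW (yP i j); rewrite !mxE.
have [q [qE q0]] : exists q, q = rho m / (d * c * b) /\ 0 <= q.
  by eexists; split; [reflexivity|rewrite divr_ge0 // !mulr_ge0 // ltW].
rewrite -qE in yx.
move=> i j.
apply: le_trans (mxleM nuP _ _ (mxleM nuP _ _ (mxleM nuP _ _ Dd yx) Cc) xb i j) _;
  rewrite ?mulr_ge0 ?(ltW d0) ?(ltW c0) ?(ltW b0) //.
by rewrite [d * _]mulrC qE -!mulrA mulVf ?mulr1 // !mulf_neq0 // gt_eqF.
Qed.

(** Along an ultrafilter each entry of g - 1 converges in a compact ball; the limit matrix is still
    invertible by [near1_unitmx]. *)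
Lemma congr_compact m : compact (congr_subgroup m).
Proof.
have cB : compact [set x | nu x <= rho m].
  apply: (subclosed_compact (@ball_closed _ _ _ nuP nbhsF _) ball_compact) => x /= xr.
  by apply: le_trans xr (rho_mono (leq0n m)).
rewrite compact_ultra => U UU UK.
have ent (p : 'I_N * 'I_N) : exists z, nu z <= rho m /\ forall r, 0 < r ->
    U [set g | nu ((bmx g - 1%:M) p.1 p.2 - z) < r].
  pose f g := (bmx g - 1%:M) p.1 p.2.
  have Uf : U [set g | nu (f g) <= rho m] by apply: filterS UK => g Kg; apply: Kg.
  have [z [zm zc]] := cB (f @ U) _ Uf.
  exists z; split=> // r r0.
  (* A cluster point of an ultrafilter is a limit: otherwise the complement of the ball, being in
     the filter, would meet the ball. *)
  have [//|nU] := in_ultra_setVsetC [set g | nu (f g - z) < r] UU.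
  have [||w [/= nw wr]] := zc [set w | ~ nu (w - z) < r] [set w | nu (w - z) < r].
  - exact: nU.
  - by rewrite nbhsF; exists r.
  by [].
have /choice[z zP] := ent.
pose Y : 'M[F]_N := \matrix_(i, j) z (i, j).
have Yr : mxle nu (rho m) Y by move=> i j; rewrite mxE; have [] := zP (i, j).
have [g0 g0E] := bmx_surj (near1_unitmx nuP (rho_ge0 m) (rho_lt1 m) Yr).
have Kg0 : congr_subgroup m g0 by rewrite /congr_subgroup /= g0E addrC addKr.
exists g0; split=> // A /nbhs_congr[m' m'A].
have : U (fun g => forall p : 'I_N * 'I_N, nu ((bmx g - 1%:M) p.1 p.2 - z p) < rho m').
  by apply: filter_forall => p; have [_] := zP p; apply.
apply: filterS => g gP; rewrite -[g](mulVKg g0); apply: m'A.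
rewrite /congr_subgroup /= bmxM.
have -> : bmx g *m bmx g0^-1%g - 1%:M = (bmx g - bmx g0) *m bmx g0^-1%g.
  by rewrite mulmxBl bmxV.
rewrite -[rho m']mulr1; apply: mxleM => //; last exact: congr_subgroup_inv_le1 Kg0.
move=> i j; apply: ltW; have := gP (i, j); rewrite g0E opprD addrA.
by rewrite [X in _ -> nu X < _]mxE !mxE.
Qed.

Lemma congr_chain : subgroup_chain congr_subgroup.
Proof.
split.
- by move=> m i j; rewrite bmx1 subrr mxE nu0.
- exact: congr_subgroupM.
- exact: congr_subgroupV.
- by move=> m m' g mm'; apply: mxle_trans; apply: rho_mono.
- exact: congr_subgroup_conj.
move=> m m'; apply: (compact_finite_nbhs_cover
  (U := fun x => [set y | congr_subgroup m' (x^-1 * y)%g]) (@congr_compact m)) => x.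
by apply/nbhs_congr; exists m' => k Kk /=; rewrite mulKg.
Qed.

Lemma congr_compact_open m : compact_open_subgroup (congr_subgroup m).
Proof.
split; [exact: congr_compact| |exact: (chain1 congr_chain)|exact: (chainM congr_chain)|exact: (chainV congr_chain)].
rewrite openE => x Kx; apply/nbhs_congr; exists m => k.
exact: (chainM congr_chain).
Qed.

Lemma congr_tr m g : congr_subgroup m g -> congr_subgroup m (GL_tr eP g).
Proof.
move=> Kg i j; rewrite /bmx mxof_GL_tr; have := Kg j i.
by rewrite !mxE eq_sym.
Qed.

Lemma GL_trM g h : GL_tr eP (g * h)%g = (GL_tr eP h * GL_tr eP g)%g.
Proof. by apply: bmx_inj; rewrite bmxM /bmx !mxof_GL_tr -trmx_mul -/(bmx _) bmxM. Qed.

Lemma GL_trK : involutive (GL_tr eP).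
Proof. by move=> g; apply: bmx_inj; rewrite /bmx !mxof_GL_tr trmxK. Qed.

Lemma GL_unimodular (K : numFieldType) (two_neq0 : (2%:R : F) != 0) g :
  modulus congr_subgroup K g = 1.
Proof.
(* A section of [bmx] on invertible matrices carries the modulus to a function of matrices; singular
   ones go to 1. *)
have /choice[gl glP] : forall X : 'M[F]_N, exists g, X \in unitmx -> bmx g = X.
  move=> X; have [/bmx_surj[h hE]|nu'] := boolP (X \in unitmx); first by exists h.
  by exists 1%g.
have glE h : gl (bmx h) = h by apply: bmx_inj; rewrite glP // bmx_unit.
rewrite -(glE g).
apply: (trivial_unit_character two_neq0 (x := fun X => modulus congr_subgroup K (gl X) : K));
  last exact: bmx_unit.
- move=> A B uA uB; rewrite -(modulusM congr_chain).
  have -> : gl (A *m B) = (gl B * gl A)%g.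
    by apply: bmx_inj; rewrite bmxM !glP // unitmx_mul uA.
  by rewrite !(modulusM congr_chain) mulrC.
- move=> A uA; have -> : gl A^T = GL_tr eP (gl A).
    by apply: bmx_inj; rewrite glP ?unitmx_tr // /bmx mxof_GL_tr -/(bmx _) glP.
  exact: (modulus_anti congr_chain K GL_trM GL_trK congr_tr).
- by move=> A _; apply: (modulus_ge0 congr_chain).
Qed.

End GeneralLinearChain.

(** * Multiplicity one *)

Section Subgroup.
Variables (R : realType) (G H : groupType) (f : UMagmaMorphism.type H G).
Variables (KG : nat -> set G) (KH : nat -> set H).
Hypotheses (chG : subgroup_chain KG) (chH : subgroup_chain KH).
Hypothesis fK : forall m h, KG m (f h) <-> KH m h.

(** A coset of [KG m] pulls back to at most one coset of [KH m]; [k] picks a point of it. *)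
Lemma Step_pullback (Z : nmodType) (F : G -> Z) : Step KG F -> Step KH (fun h => F (f h)).
Proof.
move=> [m [r [s cs]]]; exists m; split=> [x k /fK Kk|]; first by rewrite gmulfM r.
have /choice[k kP] : forall y, exists h, (exists h', KG m (y^-1 * f h')%g) -> KG m (y^-1 * f h)%g.
  move=> y; have [[h yh]|nh] := pselect (exists h', KG m (y^-1 * f h')%g); first by exists h.
  by exists 1%g.
exists [seq k y | y <- s] => x /cs[y ys yx]; exists (k y); first exact: map_f.
apply/fK; rewrite gmulfM gmulfV.
by apply: (chain_trans chG (chain_sym chG (kP y _)) yx); exists x.
Qed.

(** Each coset y [KH m] is thickened to f(y) [KG m], whose preimage is again y [KH m]. *)
Lemma Step_extension (p : H -> R[i]^o) : Step KH p ->
  exists2 F : G -> R[i]^o, Step KG F & forall h, F (f h) = p h.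
Proof.
move=> /(Step_transversal chH)[m [s [r ts cs]]].
exists (fun g => \sum_(y <- s) ind KG m (p y) ((f y)^-1 * g)%g).
  exists m; split=> [x k Kk|].
    by apply: eq_bigr => y _; rewrite mulgA (ind_rinv chG).
  exists [seq f y | y <- s] => x /= nz; apply: contrapT => nK.
  case/eqP: nz; rewrite big_seq big1 // => y ys; rewrite /ind; case: asboolP => // Kx.
  by case: nK; exists (f y) => //; apply: map_f.
move=> h; rewrite (sum_ind chH _ r ts cs); apply: eq_bigr => y _.
rewrite -gmulfV -gmulfM; congr (if _ then _ else _).
by apply/asboolP/asboolP => /fK.
Qed.

End Subgroup.

(** * Hecke operators in E (x) E *)

Section InvariantForms.
Variables (R : realType) (G : groupType) (Kc : nat -> set G).
Hypothesis ch : subgroup_chain Kc.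
Hypothesis unimodular : forall g, modulus Kc R[i] g = 1.
Variable t : G -> G.
Hypotheses (tM : forall x y, t (x * y)%g = (t y * t x)%g) (tK : involutive t).
Hypothesis tKc : forall m x, Kc m x -> Kc m (t x).
Variables (E : lmodType R[i]) (pi : representation G E).
Hypothesis smooth_pi : forall v, exists m, forall k, Kc m k -> pi k v = v.
Hypothesis fixed_fin : forall m, finite_dim [set v | forall k, Kc m k -> pi k v = v].
Hypothesis irr : rep_irreducible pi.
Variables (b : E -> E -> R[i]^o) (eps : R[i]).
Hypothesis bP : invariant_form pi t b eps.

Local Notation op := (hop Kc pi).
Implicit Types f : G -> R[i].

Let Step_anti' f : Step Kc f -> Step Kc (f \o t) := @Step_anti _ _ ch _ tM tK tKc _ f.

Lemma hop_adjoint f u v : Step Kc f -> b (op f u) v = b u (op (f \o t) v).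
Proof.
move=> Sf; have bb := form_bilin bP.
have Sfv := Step_hop ch smooth_pi v (Step_anti' Sf).
rewrite /hop -(haar_linear ch (L := fun x => b x v) (bilinl bb v)); last exact: Step_hop.
rewrite -(haar_linear ch (L := b u) (bilinr bb u)) // -[RHS](haar_anti ch tM tK tKc unimodular).
  congr haar; apply/funext => g.
  by rewrite /= tK (linear_funZ (bilinl bb v)) (linear_funZ (bilinr bb u)) (form_inv bP).
by apply: Step_comp Sfv => //; apply: linear_fun0 (bilinr bb u).
Qed.

Definition form_ev (w x : E) : R[i]^o := b x w.

Lemma form_ev_bilin : bilin form_ev.
Proof. by split=> [x|w]; [exact: (bilinr (form_bilin bP))|exact: (bilinl (form_bilin bP))]. Qed.

Lemma form_ev_inj w : (forall x, form_ev w x = 0) -> w = 0.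
Proof.
by move=> w0; apply: (form_nondeg bP) => x; rewrite (form_sym bP) [b x w]w0 mulr0.
Qed.

Definition act_tr (a : seq (R[i] * G)) := [seq (p.1, t p.2) | p <- a].

Lemma form_act a u v : b (act pi a u) v = b u (act pi (act_tr a) v).
Proof.
have bb := form_bilin bP.
rewrite /act (linear_fun_sumZ (bilinl bb v)) (linear_fun_sumZ (bilinr bb u)) big_map.
by apply: eq_bigr => p _; rewrite (form_inv bP).
Qed.

(** Once the leading vector [v] is independent of the others, density gives [a] killing these with
    b(a v, z) = 1. Pairing a X x with [z] isolates m(x), and moving [a] and [X] to the other side
    shows that m is b(., w). *)
Lemma adjoint_decomp l X X' : decomp (@dual_ev R[i] E) X l ->
  (forall x y, b (X x) y = b x (X' y)) -> exists l', decomp form_ev X l'.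
Proof.
have bb := form_bilin bP.
have [n] := ubnP (size l); elim: n l X X' => // n IHn [|[v m] l] X X' /=.
  by move=> _ X0 _; exists [::] => x; rewrite X0 !big_nil.
rewrite ltnS => szl Xl XX'.
have [sv|nsv] := pselect (spanned (unzip1 l) v).
  have [l' [szl' El']] := tensor_absorb m sv.
  apply: (IHn l' X X') => //; first by rewrite szl'.
  by move=> x; rewrite -(El' _ _ (bilin_ev_op (@dual_ev_bilin _ E) x)) -Xl.
have [a [as0 av]] := density irr (chain_schur smooth_pi fixed_fin irr) nsv.
have [z bz] : exists z, b (act pi a v) z = 1.
  have [z bz] : exists z, b (act pi a v) z != 0.
    apply: contrapT => nz; case/eqP: av; apply: (form_nondeg bP) => z.
    by apply: contrapT => /eqP bz; apply: nz; exists z.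
  exists ((b (act pi a v) z : R[i])^-1 *: z).
  by rewrite (linear_funZ (bilinr bb _)); apply: mulVf.
pose w := X' (act pi (act_tr a) z).
have mE x : m x = b x w.
  rewrite /w -XX' -form_act Xl big_cons /= act_linear (linear_fun_sumZ (act_linear pi a)).
  rewrite big_seq big1 ?addr0 => [|p pl]; last by rewrite as0 ?scaler0 ?map_f.
  rewrite (linear_funZ (bilinl bb _)) bz; exact/esym/mulr1.
have Xl1 : decomp (@dual_ev R[i] E) (fun x => X x - b x w *: v) l.
  by move=> x; rewrite Xl big_cons /= /dual_ev mE addrC addKr.
have [|l' l'E] := IHn l _ (fun y => X' y - b v y *: w) szl Xl1.
  move=> x y; rewrite (linear_funB (bilinl bb y)) (linear_funB (bilinr bb x)) XX'.
  rewrite (linear_funZ (bilinl bb y)) (linear_funZ (bilinr bb x)).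
  by congr (_ - _); apply: mulrC.
exists ((v, w) :: l') => x; rewrite big_cons /= -l'E /form_ev.
by rewrite addrC subrK.
Qed.

Lemma hop_form_decomp f : Step Kc f -> exists l, decomp form_ev (op f) l.
Proof.
move=> Sf; have [l fl] := hop_decomp ch smooth_pi fixed_fin Sf.
by apply: (adjoint_decomp fl) => x y; apply: hop_adjoint.
Qed.

(** pi(f o t) is the adjoint of pi(f), and the adjoint of x |-> b(x, w) v is y |-> b(v, y) w, where
    b(v, y) = [eps] b(y, v). *)
Lemma hop_anti_decomp f l : Step Kc f -> decomp form_ev (op f) l ->
  decomp form_ev (op (f \o t)) [seq (p.2, eps *: p.1) | p <- l].
Proof.
move=> Sf fl y; have bb := form_bilin bP; apply/eqP; rewrite -subr_eq0; apply/eqP.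
apply: form_ev_inj => x; rewrite /form_ev (linear_funB (bilinr bb x)) -hop_adjoint // fl.
rewrite (linear_fun_sumZ (bilinl bb y)) big_map (linear_fun_sumZ (bilinr bb x)) -sumrB.
apply: big1 => p _ /=; rewrite /form_ev (linear_funZ (bilinr bb y)) -[_ *: b y p.1](form_sym bP).
by apply/eqP; rewrite subr_eq0 [X in _ == X]mulrC.
Qed.

Lemma rank_one_form : exists f v w, [/\ Step Kc f, v != 0, w != 0 &
  forall x, op f x = b x w *: v].
Proof.
have bb := form_bilin bP.
have [f [v [m [Sf v0 [x0 mx0] fE]]]] := rank_one_hop ch smooth_pi fixed_fin irr.
have [z bz] : exists z, b v z != 0.
  apply: contrapT => nz; case/eqP: v0; apply: (form_nondeg bP) => z.
  by apply: contrapT => /eqP bz; apply: nz; exists z.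
pose w := (b v z : R[i])^-1 *: op (f \o t) z.
have mE x : m x = b x w.
  rewrite /w (linear_funZ (bilinr bb _)) -hop_adjoint // fE (linear_funZ (bilinl bb _)).
  by rewrite -[LHS](mulfK bz) mulrC.
exists f, v, w; split=> // [|x]; last by rewrite fE mE.
by apply: contra_neq mx0 => w0; rewrite mE w0 (linear_fun0 (bilinr bb _)).
Qed.

Definition form_distr (beta : E -> E -> R[i]^o) (f : G -> R[i]) : R[i] :=
  tensor_form form_ev beta (op f).

Section Beta.
Variable beta : E -> E -> R[i]^o.
Hypothesis bbeta : bilin beta.

Lemma form_distrE f l : decomp form_ev (op f) l ->
  form_distr beta f = \sum_(p <- l) beta p.1 p.2.
Proof. by move=> fl; exact: (tensor_formE form_ev_bilin form_ev_inj bbeta fl). Qed.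

Lemma form_distr_comb a f h : Step Kc f -> Step Kc h ->
  form_distr beta (fun x => a * f x + h x) = a * form_distr beta f + form_distr beta h.
Proof.
move=> Sf Sh; have [l fl] := hop_form_decomp Sf; have [l' hl] := hop_form_decomp Sh.
apply: (tensor_form_comb form_ev_bilin form_ev_inj bbeta fl hl).
by move=> x; exact (hop_comb ch smooth_pi a x Sf Sh).
Qed.

Lemma form_distr_conj f k : Step Kc f ->
  (forall u v, beta (pi k^-1%g u) (pi (t k) v) = beta u v) ->
  form_distr beta (fun x => f (k * x * k^-1)%g) = form_distr beta f.
Proof.
move=> Sf betak; have [l fl] := hop_form_decomp Sf; rewrite (form_distrE fl).
rewrite (@form_distrE _ [seq (pi k^-1%g p.1, pi (t k) p.2) | p <- l]).
  by rewrite big_map /=; apply: eq_bigr => p _; apply: betak.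
move=> x; rewrite (hop_conj ch smooth_pi unimodular) // fl big_map linear_sum /=; apply: eq_bigr => p _ /=.
by rewrite linearZ /form_ev (form_inv bP).
Qed.

(** Some test function acts as the rank one tensor (g v0) (x) (h w0); invariance under [t] gives the
    identity there, and the translates of v0 and of w0 span E. *)
Lemma form_distr_anti_sym :
  (forall f, Step Kc f -> form_distr beta (f \o t) = form_distr beta f) ->
  forall v w, beta v w = eps * (beta w v : R[i]).
Proof.
move=> anti; have [f0 [v0 [w0 [Sf0 nv0 nw0 f0E]]]] := rank_one_form.
have base g h : beta (pi g v0) (pi h w0) = eps * (beta (pi h w0) (pi g v0) : R[i]).
  (* pi(f) = pi(g) pi(f0) pi(t h), and b(pi(t h) x, w0) = b(x, pi(h) w0) as [t] is an involution. *)
  pose f x := f0 (g^-1 * (x * (t h)^-1))%g.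
  have Sf1 : Step Kc (fun x => f0 (g^-1 * x)%g) by apply: Step_left.
  have Sf : Step Kc f by apply: (Step_right ch _ Sf1).
  have fl : decomp form_ev (op f) [:: (pi g v0, pi h w0)].
    move=> x; rewrite big_seq1 /form_ev /=.
    have -> : op f x = op (fun y => f0 (g^-1 * y)%g) (pi (t h) x).
      exact: (hop_right ch smooth_pi unimodular (t h) x Sf1).
    by rewrite hop_left // f0E linearZ /= (form_inv bP) tK.
  have := anti f Sf; rewrite (form_distrE fl) (form_distrE (hop_anti_decomp Sf fl)).
  by rewrite !big_seq1 /= (linear_funZ (bilinr bbeta _)).
have half g w : beta (pi g v0) w = eps * (beta w (pi g v0) : R[i]).
  have [a <-] := act_transitive irr w nw0; rewrite /act.
  rewrite (linear_fun_sumZ (bilinr bbeta _)) (linear_fun_sumZ (bilinl bbeta _)) mulr_sumr.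
  by apply: eq_bigr => p _; rewrite base; apply: mulrCA.
move=> v w; have [a <-] := act_transitive irr v nv0; rewrite /act.
rewrite (linear_fun_sumZ (bilinr bbeta _)) (linear_fun_sumZ (bilinl bbeta _)) mulr_sumr.
by apply: eq_bigr => p _; rewrite half; apply: mulrCA.
Qed.

End Beta.
End InvariantForms.

Section MultiplicityOne.
Variables (R : realType) (G H : groupType) (f : UMagmaMorphism.type H G).
Variables (KG : nat -> set G) (KH : nat -> set H).
Hypotheses (chG : subgroup_chain KG) (chH : subgroup_chain KH).
Hypothesis fK : forall m h, KG m (f h) <-> KH m h.
Hypotheses (unimodG : forall g, modulus KG R[i] g = 1)
           (unimodH : forall h, modulus KH R[i] h = 1).
Variables (tG : G -> G) (tH : H -> H).
Hypotheses (tGM : forall x y, tG (x * y)%g = (tG y * tG x)%g) (tGK : involutive tG).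
Hypotheses (tHM : forall x y, tH (x * y)%g = (tH y * tH x)%g) (tHK : involutive tH).
Hypotheses (tGKG : forall m x, KG m x -> KG m (tG x))
           (tHKH : forall m x, KH m x -> KH m (tH x)).
Hypothesis tf : forall h, tG (f h) = f (tH h).
(** Phrased for functionals on bare functions, linear on [Step] only, so that characters fit
    directly; [schwartz_chain_distr] derives it. *)
Hypothesis distr : forall T : (G -> R[i]) -> R[i],
  (forall a p q, Step KG p -> Step KG q -> T (fun x => a * p x + q x) = a * T p + T q) ->
  (forall k p, Step KG p -> T (fun g => p (f k * g * (f k)^-1)%g) = T p) ->
  forall p, Step KG p -> T (p \o tG) = T p.
Variables (E E' : lmodType R[i]) (pi : representation G E) (rho : representation H E').
Hypotheses (smooth_pi : forall v, exists m, forall k, KG m k -> pi k v = v)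
  (fixed_fin_pi : forall m, finite_dim [set v | forall k, KG m k -> pi k v = v])
  (irr_pi : rep_irreducible pi).
Hypotheses (smooth_rho : forall v, exists m, forall k, KH m k -> rho k v = v)
  (fixed_fin_rho : forall m, finite_dim [set v | forall k, KH m k -> rho k v = v])
  (irr_rho : rep_irreducible rho).

Lemma form_pi_exists : exists b eps, invariant_form pi tG b eps.
Proof.
apply: (invariant_form_exists chG smooth_pi fixed_fin_pi unimodG irr_pi tGM tGK tGKG).
apply: distr => [a p q Sp Sq|k p Sp].
  exact: (chi_comb chG smooth_pi fixed_fin_pi a Sp Sq).
exact: (chi_conj chG smooth_pi fixed_fin_pi unimodG (f k) Sp).
Qed.

(** Extend [p] to [F] on G and apply [distr] to q |-> chi(q o f): by [tf], the restriction of F o tG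
    is p o tH. *)
Lemma form_rho_exists : exists b eps, invariant_form rho tH b eps.
Proof.
apply: (invariant_form_exists chH smooth_rho fixed_fin_rho unimodH irr_rho tHM tHK tHKH).
move=> p Sp; have [F SF Fp] := Step_extension chG chH fK Sp.
have Sf (q : G -> R[i]) : Step KG q -> Step KH (q \o f) := @Step_pullback _ _ _ _ _ chG fK _ q.
have := distr (T := fun q => chi KH rho (q \o f)) _ _ SF.
have -> : F \o f = p by apply/funext.
have -> : (F \o tG) \o f = p \o tH by apply/funext => h; rewrite /= tf Fp.
apply=> [a q r Sq Sr|k q Sq].
  exact (chi_comb chH smooth_rho fixed_fin_rho a (Sf _ Sq) (Sf _ Sr)).
rewrite -[RHS](chi_conj chH smooth_rho fixed_fin_rho unimodH k (Sf _ Sq)).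
by congr chi; apply/funext => h; rewrite /= !gmulfM gmulfV.
Qed.

Lemma Hom_proportional (A B : E -> E') :
  rep_Hom (rep_restrict f pi) rho A -> rep_Hom (rep_restrict f pi) rho B ->
  (exists v, A v != 0) -> exists c, forall v, B v = c *: A v.
Proof.
move=> [lA eA] [lB eB] [v0 Av0].
have [b [eps bP]] := form_pi_exists; have [d [del dP]] := form_rho_exists.
have bd := form_bilin dP.
pose beta v w := d (A v) (B w).
have bbeta : bilin beta.
  by split=> [w|v] a x y; rewrite /beta ?lA ?lB ?(bilinl bd) ?(bilinr bd).
have beta_sym v w : beta v w = eps * (beta w v : R[i]).
  apply: (form_distr_anti_sym chG unimodG tGM tGK tGKG smooth_pi fixed_fin_pi irr_pi bP bbeta).
  apply: distr => [a p q Sp Sq|k p Sp].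
    exact: (form_distr_comb chG unimodG tGM tGK tGKG smooth_pi fixed_fin_pi irr_pi bP bbeta a Sp Sq).
  apply: (form_distr_conj chG unimodG tGM tGK tGKG smooth_pi fixed_fin_pi irr_pi bP bbeta Sp).
  (* Moving rho(k^-1) across [d] yields rho(t(k^-1)) rho(t k), the identity since [tH] reverses
     products. *)
  move=> x y; rewrite /beta tf -gmulfV eA eB (form_inv dP) -repM.
  by rewrite -tHM mulgV (anti1 tHM) rep1.
have rangeA w : exists v, A v = w.
  apply: (irreducible_set irr_rho (S := [set w | exists v, A v = w])).
  - by move=> c _ _ [x <-] [y <-]; exists (c *: x + y); rewrite lA.
  - by move=> h _ [x <-]; exists (pi (f h) x); rewrite eA.
  - by exists (A v0); [exists v0|].
(* Every w is some A x, and up to signs d(B v, A x) is beta(x, v), hence beta(v, x) = d(A v, B x) =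
   0. *)
have kerA v : A v = 0 -> B v = 0.
  move=> Av; apply: (form_nondeg dP) => w; have [x <-] := rangeA w.
  rewrite (form_sym dP) -/(beta x v) beta_sym /beta Av.
  by rewrite (linear_fun0 (bilinl bd _)) !mulr0.
(* B factors through A: composed with a section [k] of A it commutes with rho, so Schur's lemma
   applies. *)
have /choice[k kP] := rangeA.
have BE v : B (k (A v)) = B v.
  apply/eqP; rewrite -subr_eq0 -(linear_funB lB); apply/eqP/kerA.
  by rewrite (linear_funB lA) kP subrr.
have [||c cE] := @chain_schur _ _ _ _ _ smooth_rho fixed_fin_rho irr_rho (fun w => B (k w)).
- move=> a x y; have [u <-] := rangeA x; have [v <-] := rangeA y.
  by rewrite -lA !BE lB.
- by move=> h w; have [u <-] := rangeA w; rewrite -eA !BE eB.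
by exists c => v; rewrite -BE cE.
Qed.

Lemma Hom_dim_le1 : dim_le (rep_Hom (rep_restrict f pi) rho) 1.
Proof.
have [[A HA nA]|nex] := pselect (exists2 A, rep_Hom (rep_restrict f pi) rho A &
  exists v, A v != 0).
  exists (fun=> A) => // B HB; have [c cE] := Hom_proportional HA HB nA.
  by exists (fun=> c); apply/funext => v; rewrite big_ord1 cE.
have H0 A : rep_Hom (rep_restrict f pi) rho A -> A = 0.
  move=> HA; apply/funext => v; apply: contrapT => /eqP nA; apply: nex.
  by exists A => //; exists v.
exists (fun=> 0) => [_|A /H0 ->].
  split=> [a u v|h v]; first by rewrite scaler0 addr0.
  by rewrite -[RHS]/(rho h 0) linear0.
by exists (fun=> 0); rewrite big_ord1 scaler0.
Qed.

End MultiplicityOne.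

Lemma distrib_of_linear (R : realType) (X : topologicalType) (T : schwartz R X -> R[i]) :
  scalar T -> exists T' : distrib R X, forall p, T' p = T p.
Proof.
move=> lT.
pose L := GRing.isLinear.Build R[i] (schwartz R X) R[i] *%R T lT.
pose T' : distrib R X := HB.pack T L.
by exists T'.
Qed.

Lemma smooth_chain (R : realType) (G : preTopologicalGroupType) (Kc : nat -> set G)
  (E : lmodType R[i]) (pi : representation G E) :
  (forall (x : G) (A : set G), nbhs x A <-> exists m, forall k, Kc m k -> A (x * k)%g) ->
  rep_smooth pi -> forall v, exists m, forall k, Kc m k -> pi k v = v.
Proof.
move=> nbhsK sm v; have /nbhsK[m mP] : nbhs (1%g : G) [set g | pi g v = v].
  by apply: open_nbhs_nbhs; split; [exact: sm|rewrite /= rep1].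
by exists m => k /mP; rewrite mul1g.
Qed.

(** Schwartz functions are the complex [Step] functions, so [T] restricts to a distribution. *)
Lemma schwartz_chain_distr (R : realType) (G : preTopologicalGroupType) (Kc : nat -> set G)
    (I : Type) (c : I -> G) (t : G -> G) :
  subgroup_chain Kc ->
  (forall (x : G) (A : set G), nbhs x A <-> exists m, forall k, Kc m k -> A (x * k)%g) ->
  (forall m, compact (Kc m)) ->
  (forall p : G -> R[i], Step Kc p -> Step Kc (p \o t)) ->
  (forall T : distrib R G,
     (forall i, distr_invariant T (fun g => (c i * g * (c i)^-1)%g)) -> distr_invariant T t) ->
  forall T : (G -> R[i]) -> R[i],
  (forall a p q, Step Kc p -> Step Kc q -> T (fun x => a * p x + q x) = a * T p + T q) ->
  (forall i p, Step Kc p -> T (fun g => p (c i * g * (c i)^-1)%g) = T p) ->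
  forall p, Step Kc p -> T (p \o t) = T p.
Proof.
move=> ch nbhsK cptK St distr T Tlin Tinv p Sp.
have Sch q : Step Kc q -> exists h : schwartz R G, (h : G -> R[i]) = q.
  by move=> Sq; exists (Schwartz (Step_schwartz nbhsK cptK Sq)).
have SS := @schwartz_Step R _ _ ch nbhsK.
have [T' T'E] : exists T' : distrib R G, forall h, T' h = T h.
  apply: (distrib_of_linear (T := fun h : schwartz R G => T h)) => a u v.
  exact (Tlin a u v (SS u) (SS v)).
have [h hE] := Sch p Sp; have [h' h'E] := Sch _ (St p Sp).
have := distr T' _ h h'; rewrite !T'E h'E hE; apply=> // i u v uv.
by rewrite !T'E uv -[RHS](Tinv i); last exact: SS.
Qed.

Lemma mxof_coord (F : fieldType) (E : vectType F) (e : (\dim {:E}).-tuple E) (g : 'End(E)) i j :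
  free e -> passmx.mxof e e g i j = coord e j (g e`_i).
Proof.
move=> fe; rewrite mxE /= /passmx.rVof mxE; congr (coord e j (g _)).
by rewrite passmx.vecof_delta.
Qed.

(** * Block form of the embedding in an adapted basis *)

Section Adapted.
Variables (F : fieldType) (W : vectType F) (V U : {vspace W}).
Hypothesis VU : direct_sum_decomposition V U.
Variables (e : (\dim {:W}).-tuple W) (b : seq W) (u : W).
Hypotheses (eP : basis_of {:W} e) (eE : e = rcons b u :> seq W).
Hypotheses (bP : basis_of V b) (uU : u \in U).

Lemma size_sub_basis : size (map (vsproj V) b) == \dim {:subvs_of V}.
Proof. by rewrite size_map -(size_basis (X := in_tuple b) bP) dimvf. Qed.

Definition sub_basis : (\dim {:subvs_of V}).-tuple (subvs_of V) := Tuple size_sub_basis.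

Lemma sub_basisP : basis_of {:subvs_of V} sub_basis.
Proof.
rewrite basisEdim; apply/andP; split; last by rewrite size_tuple.
apply/subvP => v _; have : vsval v \in <<b>>%VS by rewrite (span_basis bP) subvsP.
move=> /(memv_img (linfun (vsproj V))); rewrite limg_span lfunE /= vsvalK.
by congr (_ \in <<_>>%VS); apply: eq_map => w; rewrite lfunE.
Qed.

Lemma size_b : size b = \dim {:subvs_of V}.
Proof. by have /eqP := size_sub_basis; rewrite size_map. Qed.

Lemma adapted_val (k : nat) : (k < size b)%N -> e`_k = vsval sub_basis`_k.
Proof.
move=> kb; rewrite eE nth_rcons kb /= (nth_map 0) // vsprojK //.
by apply: (basis_mem bP); apply: mem_nth.
Qed.

Lemma adapted_last : e`_(size b) = u.
Proof. by rewrite eE nth_rcons ltnn eqxx. Qed.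

Lemma adapted_dim : \dim {:W} = (size b).+1.
Proof. by rewrite -(size_tuple e) eE size_rcons. Qed.

Lemma adapted_coord (v : subvs_of V) (j : 'I_(\dim {:W})) :
  (forall j' : 'I_(\dim {:subvs_of V}), j = j' :> nat ->
     coord e j (vsval v) = coord sub_basis j' v) /\
  (j = size b :> nat -> coord e j (vsval v) = 0).
Proof.
have fe := basis_free eP.
have vE := coord_basis sub_basisP (memvf v).
have cE : coord e j (vsval v) = \sum_k coord sub_basis k v * (j == k :> nat)%:R.
  rewrite {1}vE !linear_sum; apply: eq_bigr => k _; rewrite !linearZ /=; congr (_ * _).
  have kW : (k < \dim {:W})%N by rewrite adapted_dim size_b ltnS ltnW // ltn_ord.
  rewrite -adapted_val ?size_b // -[nat_of_ord k]/(nat_of_ord (Ordinal kW)).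
  by rewrite coord_free // -val_eqE eq_sym.
split=> [j' jj'|jb]; rewrite cE.
  rewrite (bigD1 j') //= jj' eqxx mulr1 big1 ?addr0 // => k kj.
  by rewrite val_eqE eq_sym (negbTE kj) mulr0.
rewrite big1 // => k _; rewrite jb size_b gtn_eqF ?mulr0 //.
Qed.

Lemma embed_mx_sub h (i j : 'I_(\dim {:W})) (i' j' : 'I_(\dim {:subvs_of V})) :
  i = i' :> nat -> j = j' :> nat ->
  passmx.mxof e e (GL_embed VU h) i j = passmx.mxof sub_basis sub_basis h i' j'.
Proof.
move=> ii' jj'; rewrite !mxof_coord ?(basis_free eP) ?(basis_free sub_basisP) //.
rewrite ii' adapted_val ?size_b // /GL_embed /= lfun_extend_V //.
by have [cE _] := adapted_coord (h sub_basis`_i') j; apply: cE.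
Qed.

Lemma embed_mx_last h (i j : 'I_(\dim {:W})) :
  (i = size b :> nat) \/ (j = size b :> nat) ->
  passmx.mxof e e (GL_embed VU h) i j = (i == j)%:R.
Proof.
have fe := basis_free eP.
move=> ij; rewrite mxof_coord // /GL_embed /=.
have [ib|ib] := eqVneq (i : nat) (size b).
  by rewrite ib adapted_last lfun_extend_U // -adapted_last -ib coord_free.
case: ij => [/eqP|jb]; first by rewrite (negbTE ib).
have ilt : (i < size b)%N.
  by rewrite ltn_neqAle ib /= -ltnS -adapted_dim.
rewrite adapted_val // lfun_extend_V // (adapted_coord _ j).2 //.
by rewrite -val_eqE /= jb (negbTE ib).
Qed.

Lemma adapted_split (i : 'I_(\dim {:W})) :
  (exists i' : 'I_(\dim {:subvs_of V}), i = i' :> nat) \/ i = size b :> nat.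
Proof.
have := ltn_ord i; rewrite [X in (_ < X)%N]adapted_dim ltnS leq_eqVlt => /orP[/eqP ->|]; first by right.
by rewrite [X in (_ < X)%N]size_b => ilt; left; exists (Ordinal ilt).
Qed.

(** In the basis [e] the embedding is h |-> diag(h, 1), which commutes with transposition. *)
Lemma embed_tr h :
  GL_tr eP (GL_embed VU h) = GL_embed VU (GL_tr sub_basisP h).
Proof.
apply/val_inj/(can_inj (passmx.mxofK eP eP)).
rewrite -[LHS]/(passmx.mxof e e (GL_tr eP (GL_embed VU h))) mxof_GL_tr.
apply/matrixP => i j; rewrite mxE.
have [[i' ii']|ib] := adapted_split i; last first.
  by rewrite !embed_mx_last 1?eq_sym //; [left|right].
have [[j' jj']|jb] := adapted_split j; last first.
  by rewrite !embed_mx_last 1?eq_sym //; [right|left].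
by rewrite (embed_mx_sub h jj' ii') (embed_mx_sub _ ii' jj') mxof_GL_tr [RHS]mxE.
Qed.

End Adapted.

(** diag(h, 1) - 1 = diag(h - 1, 0), and the zero entries satisfy every bound. *)
Lemma embed_congr_subgroup (R : realType) (F : preTopologicalFieldType) (nu : F -> R)
    (rho : nat -> R) (W : vectType F) (V U : {vspace W}) (VU : direct_sum_decomposition V U)
    (e : (\dim {:W}).-tuple W) (b : seq W) (u : W) (eP : basis_of {:W} e)
    (eE : e = rcons b u :> seq W) (bP : basis_of V b) m h :
  nonarchimedean_abs nu -> (forall k, 0 < rho k) -> u \in U ->
  congr_subgroup nu rho e m (GL_embed VU h) <->
  congr_subgroup nu rho (sub_basis bP) m h.
Proof.
have ent N (X : 'M[F]_N) i j : (X - 1%:M) i j = X i j - (i == j)%:R by rewrite !mxE.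
move=> nuP rho_gt0 uU; split=> K i j; rewrite ent /bmx.
  have lt (k : 'I_(\dim {:subvs_of V})) : (k < \dim {:W})%N.
    by rewrite (adapted_dim eE) (size_b bP) ltnS ltnW.
  have := K (Ordinal (lt i)) (Ordinal (lt j)); rewrite ent /bmx.
  by rewrite (embed_mx_sub VU eP eE bP h (i' := i) (j' := j)).
have last : i = size b :> nat \/ j = size b :> nat ->
    nu (passmx.mxof e e (GL_embed VU h) i j - (i == j)%:R) <= rho m.
  by move=> ij; rewrite (embed_mx_last VU eP eE bP uU h ij) subrr (nu0 nuP) ltW.
have [[i' ii']|ib] := adapted_split eE bP i; last by apply: last; left.
have [[j' jj']|jb] := adapted_split eE bP j; last by apply: last; right.
have := K i' j'; rewrite ent /bmx (embed_mx_sub VU eP eE bP h ii' jj').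
by rewrite -!val_eqE /= ii' jj'.
Qed.

Theorem mainTheorem4 (R : realType) (F : preTopologicalFieldType)
    (localF : nonarchimedean_local_field R F) (charF0 : [pchar F] =i pred0)
    (n : nat) (n_gt0 : (0 < n)%N) (W : vectType F) (V U : {vspace W})
    (dimW : \dim {:W} = n.+1) (dimV : \dim V = n)
    (VU : direct_sum_decomposition V U)
    (e : (\dim {:W}).-tuple W) (eP : basis_of {:W} e)
    (eVU : adapted_basis V U e) :
  (forall T : distrib R (GL W),
     (forall k : GL (subvs_of V),
        distr_invariant T
          (fun g => (GL_embed VU k * g * (GL_embed VU k)^-1)%g)) ->
     distr_invariant T (GL_tr eP)) ->
  forall (E : lmodType R[i]) (pi : representation (GL W) E)
    (E' : lmodType R[i]) (rho : representation (GL (subvs_of V)) E'),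
    rep_irreducible pi -> rep_admissible pi ->
    rep_irreducible rho -> rep_admissible rho ->
    dim_le (rep_Hom (rep_restrict (GL_embed VU) pi) rho) 1.
Proof.
move=> distr E pi E' rho irr_pi [sm_pi fin_pi] irr_rho [sm_rho fin_rho].
have [lcF [nu nuP nbhsF]] := localF.
(* The same radii serve both groups, so that the chain of GL(V) is the preimage of the chain of
   GL(W). *)
have [r [r0 r1 rmono rlim ball]] := local_field_radii nuP nbhsF lcF.
have [b [u [eE bP uU _]]] := eVU.
have two : (2%:R : F) != 0 by rewrite (pcharf0P F).1.
pose e'P := sub_basisP bP.
have chG := congr_chain nuP nbhsF r0 r1 rmono rlim ball eP.
have chH := congr_chain nuP nbhsF r0 r1 rmono rlim ball e'P.
have nbG := nbhs_congr nuP nbhsF r0 rlim eP.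
have nbH := nbhs_congr nuP nbhsF r0 rlim e'P.
have cG := congr_compact_open nuP nbhsF r0 r1 rmono rlim ball eP.
have cH := congr_compact_open nuP nbhsF r0 r1 rmono rlim ball e'P.
have trG := congr_tr (nu := nu) (rho := r) eP.
have trH := congr_tr (nu := nu) (rho := r) e'P.
have uniG := GL_unimodular nuP nbhsF r0 r1 rmono rlim ball eP _ two.
have uniH := GL_unimodular nuP nbhsF r0 r1 rmono rlim ball e'P _ two.
have St (p : GL W -> R[i]) : Step (congr_subgroup nu r e) p ->
    Step (congr_subgroup nu r e) (p \o GL_tr eP).
  exact: (Step_anti chG (GL_trM eP) (GL_trK eP) trG).
have cptG m : compact (congr_subgroup nu r e m) by have [] := cG m.
refine (Hom_dim_le1 (f := GL_embed VU) chG chH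
  (fun m h => embed_congr_subgroup VU eP eE bP m h nuP r0 uU) (uniG _) (uniH _)
  (GL_trM eP) (GL_trK eP) (GL_trM e'P) (GL_trK e'P) trG trH
  (embed_tr VU eP eE bP uU) (schwartz_chain_distr chG nbG cptG St distr)
  (smooth_chain nbG sm_pi) _ irr_pi (smooth_chain nbH sm_rho) _ irr_rho); move=> m.
  exact: fin_pi.
exact: fin_rho.
Qed.
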